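(* Let $Z=(Z_k)_{k\in\mathbb N}$ and $\overline Z=(\overline Z_k)_{k\in\mathbb N}$ be two sequences of independent real random variables with $\mathbb E(Z_k)=\mathbb E(\overline Z_k)=0$ and $\mathbb E(Z_k^2)=\mathbb E(\overline Z_k^2)=1$ for all $k$. Let $c=(c(\alpha))_{\alpha\in\Gamma}$ be a family of real coefficients, symmetric and null on the diagonals, with $N_0(c,1)<\infty$, and let $S(c,Z)=\sum_{m=1}^\infty\sum_{\alpha\in\Gamma_m}c(\alpha)Z^\alpha$. A. Suppose that $M_3:=\overline M_3^2(Z)\vee\overline M_3^2(\overline Z)<\infty$. Then for every $f\in C_b^3(\mathbb R)$, $$\big|\mathbb E(f(S(c,Z)))-\mathbb E(f(S(c,\overline Z)))\big|\le \tfrac13\|f^{(3)}\|_\infty\, M_3^3\,N_0(c,M_3)^2\,\varepsilon_0(c,M_3).$$ B. Suppose moreover that $\mathbb E(Z_k^3)=\mathbb E(\overline Z_k^3)=0$ for all $k$ and that $M_4:=\overline M_4^2(Z)\vee\overline M_4^2(\overline Z)<\infty$. Then for every $f\in C_b^4(\mathbb R)$, $$\big|\mathbb E(f(S(c,Z)))-\mathbb E(f(S(c,\overline Z)))\big|\le \tfrac1{12}\|f^{(4)}\|_\infty\, M_4^4\,N_0(c,M_4)^2\,\varepsilon_0^2(c,M_4).$$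
   Context: $\mathbb N=\{1,2,\dots\}$. $\Gamma_m=\mathbb N^m$ is the set of multi-indices of length $m$, $\Gamma_0=\{\emptyset\}$, $\Gamma=\bigcup_{m\ge0}\Gamma_m$. For $\alpha=(\alpha_1,\dots,\alpha_m)\in\Gamma_m$, $Z^\alpha=\prod_{i=1}^m Z_{\alpha_i}$. Coefficients $c(\alpha)$ are symmetric (invariant under permutations of the components of $\alpha$) and null on the diagonals ($c(\alpha)=0$ if $\alpha_i=\alpha_j$ for some $i\ne j$); there is no constant term, i.e. $c(\emptyset)=0$. For $k\in\mathbb N$ and $\alpha\in\Gamma_m$, $(k,\alpha)=(k,\alpha_1,\dots,\alpha_m)\in\Gamma_{m+1}$, and $c(k,\emptyset)=c(k)$. $|c|_m=\big(\sum_{\alpha\in\Gamma_m}c(\alpha)^2\big)^{1/2}$. For $M>0$, $N_0(c,M)=\big(\sum_{m=0}^\infty M^m\,m!\,|c|_m^2\big)^{1/2}$ and $\varepsilon_0(c,M)=\sup_k\big(\sum_{m=0}^\infty M^{2m}\,m!\sum_{\alpha\in\Gamma_m}c^2(k,\alpha)\big)^{1/2}$. The series $S(c,Z)$ converges in $L^2$ when $N_0(c,1)<\infty$. $M_p(Z)=\max_k\mathbb E(|Z_k|^p)$ and $\overline M_p(Z)=b_pM_p(Z)$, where, for $p\ge2$, $b_p\ge1$ is the universal constant in Burkholder's inequality: for every Hilbert-space-valued discrete-time martingale $(M_n)$ with $M_0=0$ and differences $\Delta_k=M_k-M_{k-1}$, $\ (\mathbb E|M_n|^p)^{1/p}\le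 b_p\big(\mathbb E\big((\sum_{k=1}^n|\Delta_k|^2)^{p/2}\big)\big)^{1/p}$. $C_b^j(\mathbb R)$: $j$ times continuously differentiable functions, bounded with bounded derivatives up to order $j$. *)

(* Defs.v *)
From HB Require Import structures.
From mathcomp Require Import all_boot all_order all_algebra finmap.
From mathcomp Require Import sesquilinear.
From mathcomp Require Import all_classical all_reals all_analysis.
From mathcomp Require summability.

Set Implicit Arguments.
Unset Strict Implicit.
Unset Printing Implicit Defensive.
Import Order.TTheory GRing.Theory Num.Theory.
Import numFieldNormedType.Exports.

Local Open Scope classical_set_scope.
Local Open Scope ring_scope.

(* The index set {1, 2, ...} of the sequences is re-indexed by nat, so that a
   multi-index of length m is an m.-tuple nat and the set of all multi-indices
   is seq nat. *)

Section Independence.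
Context d (T : measurableType d) (R : realType) (P : probability T R).

Definition mutually_independent (X : nat -> {RV P >-> R}) : Prop :=
  forall (J : {fset nat}) (B : nat -> set R),
    (forall k, measurable (B k)) ->
    P (\bigcap_(k in [set` J]) (X k @^-1` B k)) =
    (\prod_(k <- J) P (X k @^-1` B k))%E.

End Independence.

(* Hilbert spaces are complete normed modules over R whose norm comes from an
   inner product ip. *)
Section HilbertMartingale.
Context d (T : measurableType d) (R : realType) (P : probability T R).
Context (H : completeNormedModType R) (ip : {dot H for idfun}).

Definition filtration (F : nat -> set (set T)) : Prop :=
  (forall n, sigma_algebra setT (F n) /\ F n `<=` measurable) /\
  (forall m n, (m <= n)%N -> F m `<=` F n).

Definition strongly_measurable (G : set (set T)) (X : T -> H) : Prop :=
  (forall U : set H, open U -> G (X @^-1` U)) /\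
  (exists2 D : set H, countable D & range X `<=` closure D).

(* E[X | G] = Y.  The H-valued identity E[Y 1_A] = E[X 1_A] is an identity
   between integrals that are determined by their inner products with the
   vectors of H: <E[V], h> = E<V, h>. *)
Definition is_cond_expectation (G : set (set T)) (X Y : T -> H) : Prop :=
  strongly_measurable G Y /\
  forall (A : set T) (h : H), G A ->
    (\int[P]_(w in A) (ip (Y w) h)%:E = \int[P]_(w in A) (ip (X w) h)%:E)%E.

Definition martingale (F : nat -> set (set T)) (M : nat -> T -> H) : Prop :=
  [/\ filtration F,
      forall n, strongly_measurable (F n) (M n),
      forall n, P.-integrable setT (fun w => `|M n w|%:E) &
      forall n, is_cond_expectation (F n) (M n.+1) (M n)].

End HilbertMartingale.

(* b is an admissible constant in Burkholder's inequality with exponent p. *)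
Definition Burkholder_constant (R : realType) (p b : R) : Prop :=
  1 <= b /\
  forall (H : completeNormedModType R) (ip : {dot H for idfun}),
    (forall x : H, ip x x = `|x| ^+ 2) ->
  forall d (T : measurableType d) (P : probability T R)
    (F : nat -> set (set T)) (M : nat -> T -> H),
    martingale P ip F M -> (forall w, M 0%N w = 0) ->
  forall n : nat,
    ('E_P[fun w => (`|M n w| `^ p)%R] `^ p^-1 <=
     b%:E * 'E_P[fun w =>
       ((\sum_(k < n) `|M k.+1 w - M k w| ^+ 2) `^ (p / 2))%R] `^ p^-1)%E.

Section Coefficients.
Context (R : realType).
Implicit Types (c : seq nat -> R) (M : R).

Definition symmetric_coeff c : Prop :=
  forall a a' : seq nat, perm_eq a a' -> c a = c a'.

Definition null_on_diagonals c : Prop :=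
  forall a : seq nat, ~~ uniq a -> c a = 0.

Local Open Scope ereal_scope.

Definition coeff_norm c (m : nat) : \bar R :=
  sqrte (\esum_(a in [set: m.-tuple nat]) ((c a) ^+ 2)%:E).

Definition N0 c M : \bar R :=
  sqrte (\sum_(0 <= m <oo) (M ^+ m * m`!%:R)%:E * coeff_norm c m ^+ 2).

Definition eps0 c M : \bar R :=
  ereal_sup (range (fun k : nat =>
    sqrte (\sum_(0 <= m <oo) (M ^+ (2 * m) * m`!%:R)%:E *
      \esum_(a in [set: m.-tuple nat]) ((c (k :: a)) ^+ 2)%:E))).

End Coefficients.

Section Series.
Context d (T : measurableType d) (R : realType) (P : probability T R).
Implicit Types (c : seq nat -> R) (Z : nat -> {RV P >-> R}).

Definition monomial Z (a : seq nat) (w : T) : R := \prod_(k <- a) Z k w.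

(* X = \sum_(a in Gamma_m) c(a) Z^a, as an unordered sum in L^2: limit along
   the finite sets of multi-indices directed by inclusion. *)
Definition is_chaos c Z (m : nat) (X : {RV P >-> R}) : Prop :=
  (fun A : {fset m.-tuple nat} =>
     Lnorm P 2%:E (fun w => (X w - \sum_(a <- A) c a * monomial Z a w)%:E))
    @ summability.totally --> 0%E.

(* S = S(c, Z), i.e. S is a version of the L^2 sum of the series. *)
Definition is_stoch_series c Z (S : {RV P >-> R}) : Prop :=
  exists2 X : nat -> {RV P >-> R},
    forall m, is_chaos c Z m (X m) &
    Lnorm P 2%:E (fun w => (S w - \sum_(1 <= m < n) X m w)%:E)
      @[n --> \oo] --> 0%E.

Local Open Scope ereal_scope.

Definition abs_moment Z (p : R) : \bar R :=
  ereal_sup (range (fun k : nat => 'E_P[fun w => (`|Z k w| `^ p)%R])).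

Definition Mbar (b : R -> R) Z (p : R) : \bar R := (b p)%:E * abs_moment Z p.

End Series.

Section SmoothFunctions.
Context (R : realType).

Definition Cb (j : nat) (f : R -> R) : Prop :=
  [/\ forall i, (i < j)%N -> forall x, derivable (derive1n i f) x 1,
      continuous (derive1n j f) &
      forall i, (i <= j)%N -> bounded_fun (derive1n i f)].

Definition supnorm (g : R -> R) : \bar R :=
  ereal_sup (range (fun x => `|g x|%:E)).

End SmoothFunctions.

(* Main.v *)
Require Import Defs.
From HB Require Import structures.
From mathcomp Require Import all_boot all_order all_algebra finmap.
From mathcomp Require Import all_classical all_reals all_analysis.
From mathcomp Require Import measurable_realfun.
From mathcomp Require Import zify ring lra.
Set Implicit Arguments.
Unset Strict Implicit.
Unset Printing Implicit Defensive.
Import Order.TTheory GRing.Theory Num.Theory.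
Import numFieldNormedType.Exports.
Local Open Scope classical_set_scope.
Local Open Scope ring_scope.


(** Both estimates come from Lindeberg's replacement of the [Z_k] by the [Z'_k]
    one at a time, applied to truncations of the series, which converge to [S]
    and [S'] in L^2.  On the product space the truncated sum is an affine
    function [A + X_k B] of the [k]-th variable, with [A] and [B] independent of
    [X_k]; since the moments of order less than [p] (p = 3, 4) agree, one
    replacement costs at most [2 |f^(p)| / p! * mu * E|B|^p], where [mu] is the
    largest absolute moment of order [p].

    [E|B|^p] is controlled by hypercontractivity,
    [E|Q|^p <= (sum_A K^|A| q(A)^2)^(p/2)] for the multilinear polynomial with
    coefficients [q], by induction on the number of variables.  This holds with
    [K = 7/3 mu] for [p = 3] and, the third moments being zero, [K = 3 mu] for
    [p = 4].  The coefficients of [B] carry factors [m + 1] from differentiating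
    monomials of degree [m + 1]; they are absorbed because [K <= 3/4 M], where
    [M = b_p^2 mu^2] is the constant of the theorem.

    That gap is a lower bound on Burkholder's constant: [b_3^2 >= 28/9] and
    [b_4^2 >= 4].  It is obtained by testing the inequality on a martingale that
    is multiplied by [g] at each step with probability [q = g^-p], and otherwise
    falls slightly and stops: each step contributes the same amount to the
    [p]-th moments on both sides, so the ratio of these amounts bounds [b_p]. *)

(** * Martingales along a single branch *)

(** The weights decide the shape of the proof. Passing from multi-indices to sets and
    differentiating leaves [K ^+ m * (m + 1) * (m + 1)!] in degree [m + 1], against
    [M ^+ (m + 1) * (m + 1)!] in [N0]. The extra [m + 1] is unbounded, so no power of [M] in front
    of the sum can pay for it, and a fixed ratio [K / M < 1] is required. The value [3 / 4] serves
    both norms: [(m + 1) * (3 / 4) ^+ m <= 2] for [N0], and [(m + 1) ^+ 2 * K ^+ m <= (3 * M) ^+ m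
    <= M ^+ (2 * m)] for [eps0], as soon as [M >= 3]. The bounds [28 / 9] and [4] on the square of
    Burkholder's constant are then exactly what is asked for: [3 / 4 * (28 / 9) = 7 / 3] and
    [3 / 4 * 4 = 3], while [mu <= mu ^+ 2] because a variance equal to one forces [mu >= 1]. *)

Section real_dot.
Context (R : realType).

(** The reals as a Hilbert space: an admissible constant is quantified over spaces with a dot
    product, so a real test martingale needs multiplication in this form. *)
Definition real_dot (x y : R^o) : R := x * y.

Let real_dot_bilinear :
  bilinear_for ( *%R : GRing.Scale.law R R) (idfun \; *%R : R -> R -> R) real_dot.
Proof.
split=> [u a x y|u a x y]; rewrite /real_dot /=.
- by rewrite mulrDl mulrA.
- by rewrite mulrDr mulrCA.
Qed.

Let real_dot_sym x y : real_dot x y = (-1) ^+ false * idfun (real_dot y x).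
Proof. by rewrite mul1r /real_dot mulrC. Qed.

Let real_dot_gt0 (u : R^o) : u != 0 -> 0 < real_dot u u.
Proof. by move=> u0; rewrite /real_dot -expr2 lt_def sqrf_eq0 u0 sqr_ge0. Qed.

HB.instance Definition _ := bilinear_isBilinear.Build R R^o R^o R
  ( *%R : GRing.Scale.law R R) (idfun \; *%R : GRing.Scale.law R R) real_dot real_dot_bilinear.
HB.instance Definition _ := isHermitianSesquilinear.Build R R^o false idfun
  real_dot real_dot_sym.
HB.instance Definition _ := isDotProduct.Build R R^o real_dot real_dot_gt0.

End real_dot.

Section discrete_measure.
Context (R : realType) (N : nat) (w : nat -> {nonneg R}).

(** Finitely many Dirac masses on [nat], where every set is measurable: expectations are finite
    sums, and integrability is immediate. *)
Definition discrete : set nat -> \bar R := msum (fun i => mscale (w i) \d_i) N.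

HB.instance Definition _ := Measure.on discrete.

Lemma integral_discrete (A : set nat) (f : nat -> R) :
  (\int[discrete]_(i in A) (f i)%:E =
   (\sum_(i < N) (w i)%:num * ((nat_of_ord i) \in A)%:R * f i)%:E)%E.
Proof.
have ge0 (g : nat -> \bar R) : (forall i, 0 <= g i)%E ->
    (\int[discrete]_(i in A) g i =
      \sum_(i < N) ((w i)%:num)%:E * ((nat_of_ord i \in A)%:R%:E * g i))%E.
  move=> g0; rewrite ge0_integral_measure_sum//.
  apply: eq_bigr => i _; rewrite ge0_integral_mscale// integral_dirac//.
rewrite integralE !ge0//=.
under eq_bigr do rewrite funeposE -EFin_max -!EFinM.
under [X in (_ - X)%E]eq_bigr do rewrite funenegE -EFinN -EFin_max -!EFinM.
rewrite !sumEFin -EFinB -sumrB; congr EFin; apply: eq_bigr => i _.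
rewrite -!mulrBr -mulrA; congr (_ * (_ * _)).
by rewrite /Num.max; case: ltP => h1; case: ltP => h2; lra.
Qed.

Lemma integrable_discrete (f : nat -> R) :
  discrete.-integrable setT (fun i => (f i)%:E).
Proof.
apply/integrableP; split=> //.
under eq_integral do rewrite abse_EFin.
by rewrite integral_discrete ltry.
Qed.

End discrete_measure.

Section branch_martingale.
Context (R : realType) (N : nat) (w : nat -> {nonneg R}) (x y : nat -> R).
Hypotheses (w1 : \sum_(i < N) (w i)%:num = 1) (x0 : x 0 = 0).
(** The martingale condition on the one atom that step [n] splits: [w n] is the mass that leaves,
    the tail sum the mass that goes on. Multiplied out, it needs no conditional probability. *)
Hypothesis balance : forall n, (n < N)%N ->
  (w n)%:num * (y n - x n) +
  (\sum_(i < N | (n < i)%N) (w i)%:num) * (x n.+1 - x n) = 0.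

Let discrete_setT : discrete N w setT = 1%E.
Proof.
rewrite /discrete /msum /= -w1 -sumEFin; apply: eq_bigr => i _.
transitivity (((w i)%:num)%:E * \d_(nat_of_ord i) [set: nat])%E => //.
by rewrite diracT mule1.
Qed.

HB.instance Definition _ :=
  Measure_isProbability.Build _ _ R (discrete N w) discrete_setT.

(* Under [discrete], the outcome [i] is the time at which the martingale leaves
   the sequence [x]: it then jumps to [y i] and stops. *)
Definition branch (n i : nat) : R^o := if (i < n)%N then y i else x n.

(** At time [n] the exit time is known only if it is below [n], so the outcomes [>= n] form a single
    atom. *)
Definition branch_filtration (n : nat) : set (set nat) :=
  [set A | forall i j, (n <= i)%N -> (n <= j)%N -> A i -> A j].

Lemma branch_filtrationP : filtration branch_filtration.
Proof.
split=> [n|m n mn A Am i j ni nj]; last by apply: Am; exact: leq_trans mn _.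
split=> //; split=> [i j _ _ []|A Am i j ni nj|A Am i j ni nj].
- by move=> [_ Ai]; split=> // Aj; apply: Ai; exact: Am Aj.
- by move=> [k _ Ak]; exists k => //; exact: Am Ak.
Qed.

Lemma branch_strongly_measurable n m : (n <= m)%N ->
  strongly_measurable (branch_filtration m) (branch n).
Proof.
move=> nm; split=> [U _ i j mi mj|].
  by rewrite /preimage /= /branch !ltnNge !(leq_trans nm).
exists (range (branch n)); last exact: subset_closure.
exact: card_image_le.
Qed.

(** Consecutive values differ only on the outcomes [>= n], and there membership in an event [A] of
    the filtration is constant. The difference of the two integrals over [A] is thus a multiple of
    the left-hand side of [balance]. *)
Lemma branch_martingale :
  martingale (discrete N w) (@real_dot R) branch_filtration branch.
Proof.
split=> [|n|n|n]; first exact: branch_filtrationP.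
- exact: branch_strongly_measurable.
- exact: integrable_discrete.
split=> [|A h An]; first exact: branch_strongly_measurable.
rewrite !integral_discrete; congr EFin; apply/eqP.
rewrite -subr_eq0 -sumrB; apply/eqP.
have [Nn|nN] := leqP N n.
  apply: big1 => i _; rewrite /branch !(leq_trans (ltn_ord i)) ?subrr//.
  exact: leq_trans Nn _.
pose a : R := (n \in A)%:R; pose k : R := h.
rewrite (eq_bigr (fun i : 'I_N => a * k *
   ((if (i == n :> nat) then (w i)%:num * (x n - y n) else 0) +
    (if (n < i)%N then (w i)%:num * (x n - x n.+1) else 0)))); last first.
  move=> i _; rewrite /branch ltnS.
  have [lin|lni|eqin] := ltngtP i n.
  - by rewrite subrr addr0 mulr0.
  - have -> : (nat_of_ord i \in A) = (n \in A).
      by apply/idP/idP; rewrite !inE => Ai; apply: An Ai => //; exact: ltnW.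
    transitivity ((w i)%:num * a * (x n * k) - (w i)%:num * a * (x n.+1 * k)) => //.
    by ring.
  - rewrite eqin.
    transitivity ((w n)%:num * a * (x n * k) - (w n)%:num * a * (y n * k)) => //.
    by ring.
rewrite -big_distrr/= big_split/= -!big_mkcond/= -big_distrl/=.
rewrite (big_pred1 (Ordinal nN)); last by [].
rewrite -big_distrl/=; have := balance nN.
set s := \sum_(_ < _ | _) _ => bal.
by rewrite -[RHS](mulr0 (- (a * k))) -bal; ring.
Qed.

Lemma Burkholder_branch (p b : R) : 0 < p -> Burkholder_constant p b ->
  \sum_(i < N) (w i)%:num * `|y i| `^ p <=
  b `^ p * \sum_(i < N) (w i)%:num *
    (\sum_(k < i) (x k.+1 - x k) ^+ 2 + (y i - x i) ^+ 2) `^ (p / 2).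
Proof.
move=> p0 [b1 /(_ R^o (@real_dot R))].
have dotE (z : R^o) : real_dot z z = `|z| ^+ 2.
  by rewrite /real_dot -expr2 real_normK// num_real.
move=> /(_ dotE _ _ _ _ _ branch_martingale).
move=> /(_ (fun=> x0) N); rewrite unlock.
rewrite !integral_discrete !poweR_EFin -EFinM lee_fin => H.
have simpl_sum (f : nat -> R) : \sum_(i < N) (w i)%:num *
    (nat_of_ord i \in [set: nat])%:R * f i = \sum_(i < N) (w i)%:num * f i.
  by apply: eq_bigr => i _; rewrite in_setT mulr1.
rewrite (simpl_sum (fun i => `|branch N i| `^ p)) (simpl_sum (fun i =>
  (\sum_(k < N) `|branch k.+1 i - branch k i| ^+ 2) `^ (p / 2))) in H.
have b0 : 0 <= b by apply: le_trans b1.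
rewrite (eq_bigr (fun i : 'I_N => (w i)%:num * `|branch N i| `^ p)); last first.
  by move=> i _; rewrite /branch ltn_ord.
rewrite [X in _ <= _ * X](eq_bigr (fun i : 'I_N => (w i)%:num *
    (\sum_(k < N) `|branch k.+1 i - branch k i| ^+ 2) `^ (p / 2))); last first.
  move=> i _; congr (_ * _ `^ _).
  (* The increments of outcome [i] are those of [x] before time [i], the exit jump at time [i], and
     zero afterwards. *)
  rewrite -(big_mkord xpredT (fun k => `|branch k.+1 i - branch k i| ^+ 2)).
  rewrite (@big_cat_nat _ _ _ i) //=; last exact: ltnW.
  rewrite (@big_ltn _ _ _ i)//= big_mkord.
  rewrite [X in _ + (_ + X)]big1_seq => [|k /=]; last first.
    rewrite mem_index_iota => /andP[ik kN].
    by rewrite /branch ik ltnW// subrr normr0 expr0n.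
  rewrite addr0; congr (_ + _).
    apply: eq_bigr => k _; rewrite /branch (ltnNge i k.+1) ltn_ord (ltnNge i k) ltnW//=.
    by rewrite real_normK// num_real.
  by rewrite /branch ltnSn ltnn real_normK// num_real.
move: H; set X := \sum_(_ < _) _; set Y := \sum_(_ < _) _ => H.
have X0 : 0 <= X by apply: sumr_ge0 => i _; rewrite mulr_ge0 ?powR_ge0.
have Y0 : 0 <= Y by apply: sumr_ge0 => i _; rewrite mulr_ge0 ?powR_ge0.
have pV (z : R) : 0 <= z -> z = (z `^ p^-1) `^ p.
  by move=> z0; rewrite -powRrM mulVf ?gt_eqF// powRr1.
rewrite (pV X X0) (pV Y Y0) -powRM ?powR_ge0//.
by apply: ge0_ler_powR; rewrite ?nnegrE ?mulr_ge0 ?powR_ge0// ltW.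
Qed.
End branch_martingale.

Lemma sum_ltn_le (n m : nat) : (\sum_(j < n) (j < m) <= m)%N.
Proof.
apply: (@leq_trans (minn n m)); last exact: geq_minr.
elim: n => [|n IH]; first by rewrite big_ord0.
rewrite big_ord_recr/=; move: IH; set s := (\sum_(_ < _) _)%N => IH.
by case: (ltnP n m) => nm /=; lia.
Qed.

(** * Lower bounds for Burkholder's constant *)

Section critical_branch.
Context (R : realType) (P : nat) (b g q l : R).
Hypotheses (P0 : (0 < P)%N) (hb : Burkholder_constant P%:R b).
Hypotheses (g1 : 1 < g) (q0 : 0 < q) (q1 : q < 1) (l0 : 0 <= l) (l1 : l <= 1).
Hypotheses (qgP : q * g ^+ P = 1) (lq : (1 - q) * l = q * (g - 1)).

(* The start is [0], so a first fair step to [1] or [-1] precedes the growth by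
   the factor [g]; [lq] is the martingale condition at the later steps. *)
Let weight (n i : nat) : R :=
  if i is j.+1 then (if (j < n)%N then q ^+ j * (1 - q) / 2 else q ^+ j / 2)
  else 2^-1.
Let pos (i : nat) : R := if i is j.+1 then g ^+ j else 0.
Let fall (n i : nat) : R :=
  if i is j.+1 then (if (j < n)%N then (1 - l) * g ^+ j else g ^+ j) else -1.

Let weight_ge0 n i : 0 <= weight n i.
Proof.
case: i => [|i] /=; first by rewrite invr_ge0.
by case: ifP => _; rewrite !mulr_ge0 ?exprn_ge0 ?invr_ge0// ?subr_ge0 ltW.
Qed.

Let w n i : {nonneg R} := NngNum (weight_ge0 n i).

(** Half of the mass survives the first step, and each further step keeps a proportion [q]; the
    outcome [n.+1] carries what survives all [n] of them. *)
Let tail n j : (j <= n)%N ->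
  \sum_(j <= i < n.+1) weight n i.+1 = q ^+ j / 2.
Proof.
move=> jn; rewrite -(subKn jn); move: (n - j)%N (leq_subr j n) => {jn}.
elim=> [|m IH] mn.
  by rewrite subn0 big_nat1 /= ltnn.
have lt : (n - m.+1 < n)%N by lia.
rewrite big_ltn; last by rewrite ltnW.
rewrite [weight _ _]/= lt subnSK// IH ?(ltnW mn)//.
by rewrite -(subnSK mn) exprS; field.
Qed.

(** [1] for the first step, then the geometric series of [((g - 1) * g ^+ k) ^+ 2]. *)
Let sq_incr j : \sum_(k < j.+1) (pos k.+1 - pos k) ^+ 2 =
  (g - 1) / (g + 1) * (g ^+ 2) ^+ j + 2 / (g + 1).
Proof.
have gn0 : g + 1 != 0 by rewrite gt_eqF// addr_gt0// (lt_trans ltr01).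
elim: j => [|j IH]; first by rewrite big_ord1 /= !expr0; field.
by rewrite big_ord_recr IH/= !(exprAC _ 2) [g ^+ j.+1]exprS; field.
Qed.

Let qg j : q ^+ j * (g ^+ j) ^+ P = 1.
Proof. by rewrite exprAC -exprMn qgP expr1n. Qed.

(** The mass [q ^+ j] cancels [(g ^+ j) ^+ P], so the square function may be divided by
    [(g ^+ j) ^+ 2]; its constant term [2 / (g + 1) <= 1] then leaves at most [(g ^- 2) ^+ j]. The
    case [z = l] is an exit by a fall, [z = 0] the mass surviving to the end. *)
Let term_le j z :
  q ^+ j * (\sum_(k < j.+1) (pos k.+1 - pos k) ^+ 2 + (z * g ^+ j) ^+ 2)
     `^ (P%:R / 2) <=
  ((g - 1) / (g + 1) + z ^+ 2 + (g ^- 2) ^+ j) `^ (P%:R / 2).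
Proof.
have g0 : 0 < g by apply: lt_trans g1.
have k0 : 0 <= (g - 1) / (g + 1).
  by rewrite divr_ge0 ?subr_ge0 ?ltW// addr_gt0.
have -> : ((g - 1) / (g + 1) + z ^+ 2 + g ^- 2 ^+ j) `^ (P%:R / 2) =
  q ^+ j * ((g ^+ j) ^+ 2 * ((g - 1) / (g + 1) + z ^+ 2 + g ^- 2 ^+ j)) `^ (P%:R / 2).
  rewrite powRM ?sqr_ge0// ?addr_ge0 ?sqr_ge0 ?exprn_ge0 ?invr_ge0 ?sqr_ge0//.
  rewrite -(@powR_mulrn _ (g ^+ j) 2) ?exprn_ge0 ?(ltW g0)// -powRrM [2%:R * (P%:R / 2)]mulrC divfK ?pnatr_eq0//.
  by rewrite powR_mulrn ?exprn_ge0 ?(ltW g0)// mulrA qg mul1r.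
rewrite ler_pM2l ?exprn_gt0//; apply: ge0_ler_powR.
- by rewrite divr_ge0.
- by rewrite nnegrE addr_ge0 ?sumr_ge0// => *; rewrite ?sqr_ge0.
- by rewrite nnegrE mulr_ge0 ?sqr_ge0// !addr_ge0 ?sqr_ge0 ?exprn_ge0 ?invr_ge0 ?sqr_ge0.
rewrite sq_incr.
have gj : (g ^+ j) ^+ 2 * (g ^- 2) ^+ j = 1.
  by rewrite exprAC -exprMn divff ?expr1n// expf_neq0 ?gt_eqF.
rewrite !mulrDr gj exprAC.
have h : 2 / (g + 1) <= 1 by rewrite ler_pdivrMr ?mul1r ?addr_gt0//; have := g1; lra.
by move: h; rewrite exprMn; set k := (g - 1) / _; set k' := 2 / _; lra.
Qed.

(** The left-hand side keeps only the [n] falls, all of equal size by [qgP]. On the right, the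
    initial loss gives [1] and the final survivors give the last term. The factor [1 / 2] common to
    all weights is cancelled. *)
Let Burkholder_critical n :
  n%:R * (1 - q) * (1 - l) ^+ P <=
  b ^+ P * (1 + (1 - q) * (\sum_(j < n)
    ((g - 1) / (g + 1) + l ^+ 2 + (g ^- 2) ^+ j) `^ (P%:R / 2)) +
    ((g - 1) / (g + 1) + l ^+ 2 + 1) `^ (P%:R / 2)).
Proof.
have bal m : (m < n.+2)%N ->
  (w n m)%:num * (fall n m - pos m) +
  (\sum_(i < n.+2 | (m < i)%N) (w n i)%:num) * (pos m.+1 - pos m) = 0.
  move=> mn; have -> : \sum_(i < n.+2 | (m < i)%N) (w n i)%:num =
      \sum_(m <= i < n.+1) weight n i.+1.
    rewrite -(big_mkord (fun i => m < i)%N (weight n)) big_ltn_cond//=.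
    rewrite big_add1 /= [RHS](@big_nat_widenl _ _ _ m 0)//.
  case: m mn => [|m] mn.
    by rewrite tail//= expr0; field.
  have [mn'|nm] := ltnP m n.
    rewrite tail//= mn' !exprS.
    have -> : q ^+ m * (1 - q) / 2 * ((1 - l) * g ^+ m - g ^+ m) =
       - (q ^+ m / 2 * g ^+ m) * ((1 - q) * l) by ring.
    by rewrite lq; field.
  rewrite big_geq ?ltnS// mul0r addr0 /=.
  by rewrite ltnNge nm /= subrr mulr0.
have tot : \sum_(i < n.+2) (w n i)%:num = 1.
  rewrite -(big_mkord xpredT (weight n)) big_ltn// big_add1 /= tail// expr0.
  by field.
have := @Burkholder_branch R n.+2 (w n) pos (fall n) tot erefl bal P%:R b.
rewrite ltr0n => /(_ P0 hb).
rewrite big_ord_recl [X in _ <= _ * X]big_ord_recl.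
rewrite big_ord_recr [X in _ <= _ * (_ + X)]big_ord_recr /=.
rewrite !add0n ltnn => H.
have b0 : 0 <= b by case: hb => b1 _; apply: le_trans b1.
rewrite -(ler_pM2l (_ : 0 < 2^-1 :> R)) ?invr_gt0//.
apply: le_trans (le_trans H _).
  rewrite -[leLHS]add0r lerD ?mulr_ge0 ?powR_ge0// ?invr_ge0//.
  rewrite -[leLHS]addr0 lerD//; last by rewrite !mulr_ge0 ?powR_ge0 ?exprn_ge0 ?invr_ge0// ltW.
  rewrite (eq_bigr (fun=> 2^-1 * ((1 - q) * (1 - l) ^+ P))); last first.
    move=> i _; rewrite add0n ltn_ord ger0_norm ?mulr_ge0 ?subr_ge0 ?exprn_ge0//; last first.
      by rewrite ltW// (lt_trans ltr01).
    rewrite powR_mulrn ?mulr_ge0 ?subr_ge0 ?exprn_ge0//; last first.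
      by rewrite ltW// (lt_trans ltr01).
    rewrite exprMn -[RHS]mulr1 -[X in _ = _ * X](qg i).
    by set y := (1 - l) ^+ P; set z := (g ^+ i) ^+ P; field.
  by rewrite sumr_const card_ord -mulr_natl; set y := _ ^+ _; lra.
rewrite powR_mulrn// mulrCA ler_wpM2l ?exprn_ge0// 2!mulrDr addrA.
have q0' := ltW q0; have q1' : 0 <= 1 - q by rewrite subr_ge0 ltW.
rewrite !lerD//.
- by rewrite big_ord0 add0r subr0 sqrrN expr1n powR1.
- rewrite !mulr_sumr; apply: ler_sum => i _; rewrite add0n ltn_ord.
  have -> : (1 - l) * g ^+ i - g ^+ i = - (l * g ^+ i) by ring.
  rewrite sqrrN; have := term_le i l.
  set X := _ `^ _; set Y := _ `^ _ => XY.
  have -> : q ^+ i * (1 - q) / 2 * X = 2^-1 * ((1 - q) * (q ^+ i * X)) by field.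
  by rewrite !ler_wpM2l ?invr_ge0.
rewrite subrr; have := term_le n 0; rewrite mul0r.
set X := _ `^ _ => XY.
have -> : q ^+ n / 2 * X = 2^-1 * (q ^+ n * X) by field.
rewrite ler_wpM2l ?invr_ge0//; apply: le_trans XY _.
have g0 : 0 < g by apply: lt_trans g1.
have k0 : 0 <= (g - 1) / (g + 1) by rewrite divr_ge0 ?subr_ge0 ?ltW// addr_gt0.
apply: ge0_ler_powR; rewrite ?nnegrE ?divr_ge0 ?addr_ge0 ?sqr_ge0 ?exprn_ge0 ?invr_ge0 ?sqr_ge0//.
rewrite expr0n/= addr0 lerD// ?lerDl ?sqr_ge0//.
by rewrite exprn_ile1// ?invr_ge0 ?sqr_ge0// invf_le1 ?exprn_gt0// exprn_ege1 ?ltW.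
Qed.

(** Both sides of [Burkholder_critical] are of order [n], so only their slopes count. The powers of
    [g ^- 2] are below [e] for all but finitely many [j]; comparing slopes and taking the power
    [2 / P] gives the claim. *)
Lemma Burkholder_critical_branch (e : R) : 0 < e ->
  (1 - l) ^+ 2 <= b ^+ 2 * ((g - 1) / (g + 1) + l ^+ 2 + e).
Proof.
move=> e0.
have g0 : 0 < g by apply: lt_trans g1.
set k := _ + l ^+ 2.
have k0 : 0 <= k.
  by rewrite addr_ge0 ?sqr_ge0// divr_ge0 ?subr_ge0 ?ltW// addr_gt0.
have BC := Burkholder_critical; rewrite -/k in BC; clearbody k.
have b0 : 0 <= b by case: hb => b1 _; apply: le_trans b1.
have [m um] : exists m, forall j, (m <= j)%N -> (g ^- 2) ^+ j <= e.
  have /cvg_expr/cvgr0_norm_le/(_ _ e0)[m _ um] : `|g ^- 2| < 1.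
    by rewrite ger0_norm ?invr_ge0 ?sqr_ge0// invf_lt1 ?exprn_gt0// exprn_egt1.
  by exists m => j mj; rewrite (le_trans (ler_norm _))//; exact: um.
set Y := (k + e) `^ (P%:R / 2); set Z := (k + 1) `^ (P%:R / 2).
have Y0 : 0 <= Y by exact: powR_ge0.
have Z0 : 0 <= Z by exact: powR_ge0.
have q1' : 0 <= 1 - q by rewrite subr_ge0 ltW.
have PZ : 0 <= P%:R / 2 :> R by rewrite divr_ge0.
have term j : (k + (g ^- 2) ^+ j) `^ (P%:R / 2) <= Y + (j < m)%N%:R * Z.
  have u0 : 0 <= (g ^- 2) ^+ j by rewrite exprn_ge0// invr_ge0 sqr_ge0.
  have [jm|mj] := ltnP j m.
    rewrite mul1r -[leLHS]add0r lerD//; apply: ge0_ler_powR; rewrite ?nnegrE ?addr_ge0//.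
    by rewrite lerD2l exprn_ile1// ?invr_ge0 ?sqr_ge0// invf_le1 ?exprn_gt0// exprn_ege1 ?ltW.
  rewrite mul0r addr0; apply: ge0_ler_powR; rewrite ?nnegrE ?addr_ge0// ?(ltW e0)//.
  by rewrite lerD2l um.
have sum_le n : \sum_(j < n) (k + (g ^- 2) ^+ j) `^ (P%:R / 2) <= n%:R * Y + m%:R * Z.
  apply: (@le_trans _ _ (\sum_(j < n) (Y + (j < m)%N%:R * Z))).
    by apply: ler_sum => j _; exact: term.
  rewrite big_split/= sumr_const card_ord -(mulr_natl Y) lerD2l -mulr_suml.
  rewrite ler_wpM2r// -natr_sum ler_nat.
  exact: sum_ltn_le.
have H n : n%:R * ((1 - q) * ((1 - l) ^+ P - b ^+ P * Y)) <=
    b ^+ P * (1 + (1 - q) * (m%:R * Z) + Z).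
  have := BC n; rewrite -/Z.
  set B := b ^+ P; set L := (1 - l) ^+ P => Hn.
  have : n%:R * (1 - q) * L <= B * (1 + (1 - q) * (n%:R * Y + m%:R * Z) + Z).
    apply: le_trans Hn _; rewrite ler_wpM2l ?exprn_ge0// lerD2r lerD2l.
    by rewrite ler_wpM2l.
  by set N : R := n%:R; lra.
(* If [D] were positive, a large [n] would exceed [C], which does not depend on [n]. *)
have {}H : (1 - l) ^+ P <= b ^+ P * Y.
  move: H; set C := b ^+ P * (_ + _); set D := (1 - l) ^+ P - _ => H.
  rewrite -subr_le0 -/D leNgt; apply/negP => D0.
  have D1 : 0 < (1 - q) * D by rewrite mulr_gt0// subr_gt0.
  have := H (Num.bound `|C / ((1 - q) * D)|); rewrite -ler_pdivlMr//.
  apply/negP; rewrite -ltNge.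
  exact: le_lt_trans (ler_norm _) (archi_boundP (normr_ge0 _)).
have YE : Y = Num.sqrt (k + e) ^+ P.
  have ke : 0 <= k + e by rewrite addr_ge0// ltW.
  by rewrite /Y mulrC powRrM powR12_sqrt// powR_mulrn// sqrtr_ge0.
rewrite YE -exprMn ler_pXn2r ?nnegrE ?subr_ge0 ?mulr_ge0 ?sqrtr_ge0// in H.
rewrite -[k + e]sqr_sqrtr ?addr_ge0 ?(ltW e0)// -exprMn.
by rewrite ler_pXn2r ?nnegrE ?subr_ge0 ?mulr_ge0 ?sqrtr_ge0.
Qed.

End critical_branch.

(* With [g = 6 / 5], [q = g^-3] and [l = q (g - 1) / (1 - q)]; [169 / 1000] is a
   rational slightly above [(g - 1) / (g + 1) + l ^+ 2]. *)
Lemma Burkholder_constant3_ge (R : realType) (b : R) :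
  Burkholder_constant 3 b -> 28 / 9 <= b ^+ 2.
Proof.
move=> hb; have := @Burkholder_critical_branch R 3 b (6 / 5) (125 / 216) (25 / 91)
  isT hb _ _ _ _ _ _ _ (169 / 1000 - 1 / 11 - (25 / 91) ^+ 2).
have -> : (6 / 5 - 1) / (6 / 5 + 1) = 1 / 11 :> R by field.
move=> H; suff : (1 - 25 / 91) ^+ 2 <= b ^+ 2 * (169 / 1000) by lra.
by have -> : 169 / 1000 = 1 / 11 + (25 / 91) ^+ 2 +
  (169 / 1000 - 1 / 11 - (25 / 91) ^+ 2) :> R; [field | apply: H; lra].
Qed.

(** Again [g = 6 / 5], now with [q = g^-4]; [165 / 1000] lies well above
    [(g - 1) / (g + 1) + l ^+ 2] and is just small enough to give [4]. *)
Lemma Burkholder_constant4_ge (R : realType) (b : R) :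
  Burkholder_constant 4 b -> 4 <= b ^+ 2.
Proof.
move=> hb; have := @Burkholder_critical_branch R 4 b (6 / 5) (625 / 1296) (125 / 671)
  isT hb _ _ _ _ _ _ _ (165 / 1000 - 1 / 11 - (125 / 671) ^+ 2).
have -> : (6 / 5 - 1) / (6 / 5 + 1) = 1 / 11 :> R by field.
move=> H; suff : (1 - 125 / 671) ^+ 2 <= b ^+ 2 * (165 / 1000) by lra.
by have -> : 165 / 1000 = 1 / 11 + (125 / 671) ^+ 2 +
  (165 / 1000 - 1 / 11 - (125 / 671) ^+ 2) :> R; [field | apply: H; lra].
Qed.

(** * Independence *)

Section independent_product.
Context d (T : measurableType d) (R : realType) (P : probability T R).
Variables U V : {RV P >-> R}.
Hypothesis UV : forall B C : set R, measurable B -> measurable C ->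
  P (U @^-1` B `&` V @^-1` C) = (P (U @^-1` B) * P (V @^-1` C))%E.
Hypotheses (iU : P.-integrable setT (EFin \o U)) (iV : P.-integrable setT (EFin \o V)).

Let pair (w : T) : R * R := (U w, V w).
Let mpair : measurable_fun setT pair.
Proof. exact: measurable_fun_pair. Qed.
HB.instance Definition _ := isMeasurableFun.Build _ _ _ _ pair mpair.
Let law2 : {measure set (R * R) -> \bar R} := distribution P pair.
Local Notation prodlaw := (distribution P U \x distribution P V)%E.
Local Notation prod_fun := (fun z : R * R => (z.1 * z.2)%:E).

Let mprod : measurable_fun [set: R * R] prod_fun.
Proof. by apply: measurableT_comp => //; exact: measurable_funM. Qed.

(** Independence is the equality of the two measures on rectangles; they then agree everywhere, and
    Fubini's theorem applies to the joint law. *)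
Let law2E A : measurable A -> prodlaw A = law2 A.
Proof.
by apply: product_measure_unique => B C mB mC; rewrite /law2 /= -UV.
Qed.

Let intU : (distribution P U).-integrable setT (fun x => x%:E).
Proof. by apply: integrable_pushforward => //; exact/measurable_EFinP. Qed.
Let intV : (distribution P V).-integrable setT (fun x => x%:E).
Proof. by apply: integrable_pushforward => //; exact/measurable_EFinP. Qed.

Let fin_abs (W : {RV P >-> R}) : P.-integrable setT (EFin \o W) ->
  (\int[distribution P W]_x `|x|%:E < +oo)%E.
Proof.
move=> iW; have : (distribution P W).-integrable setT (fun x => x%:E).
  by apply: integrable_pushforward => //; exact/measurable_EFinP.
by move/integrableP => [_].
Qed.

Let iprod : prodlaw.-integrable setT prod_fun.
Proof.
apply/integrable12ltyP => //.
rewrite (eq_integral (fun x : R =>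
  `|x|%:E * \int[distribution P V]_y `|y|%:E)%E); last first.
  move=> x _; rewrite -ge0_integralZl//.
    by apply: eq_integral => y _; rewrite /= normrM EFinM.
  by apply/measurable_EFinP; exact: normr_measurable.
rewrite ge0_integralZr//; last 2 first.
- by apply/measurable_EFinP; exact: normr_measurable.
- exact: integral_ge0.
by rewrite lte_mul_pinfty ?fin_abs ?integral_ge0// ge0_fin_numE ?fin_abs ?integral_ge0.
Qed.

Lemma integrable_independentM : P.-integrable setT (EFin \o (U \* V)).
Proof.
have : law2.-integrable setT prod_fun.
  move/integrableP: iprod => [m fin]; apply/integrableP; split => //.
  rewrite (_ : integral _ _ _ = \int[prodlaw]_z `|prod_fun z|)%E//.
  by apply: eq_measure_integral => A mA _; rewrite -[LHS]law2E.
move/integrableP => [_]; rewrite /law2 ge0_integral_pushforward//; last first.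
  exact: measurableT_comp mprod.
move=> fin; apply/integrableP; split=> //.
by apply/measurable_EFinP; exact: measurable_funM.
Qed.

Lemma Rintegral_independentM :
  \int[P]_w (U w * V w) = (\int[P]_w U w) * (\int[P]_w V w).
Proof.
rewrite /Rintegral -fineM; last 2 first.
- exact: integrable_fin_num.
- exact: integrable_fin_num.
congr fine.
transitivity (\int[law2]_z prod_fun z)%E.
  by rewrite /law2 integral_pushforward//; exact: integrable_independentM.
transitivity (\int[prodlaw]_z prod_fun z)%E.
  by apply: eq_measure_integral => A mA _; rewrite -[LHS]law2E.
rewrite -integral12_prod_meas1//=.
have lawE (W : {RV P >-> R}) : P.-integrable setT (EFin \o W) ->
    (\int[distribution P W]_x x%:E = \int[P]_w (W w)%:E)%E.
  by move=> iW; rewrite integral_pushforward//; exact/measurable_EFinP.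
rewrite (eq_integral (fun x : R =>
  x%:E * \int[distribution P V]_y y%:E)%E); last first.
  move=> x _; rewrite -integralZl//.
rewrite -[(\int[distribution P V]_y y%:E)%E]fineK; last first.
  by rewrite lawE//; exact: integrable_fin_num.
by rewrite integralZr// !lawE// fineK//; exact: integrable_fin_num.
Qed.
End independent_product.

Section cylinders.
Context d (T : measurableType d) (R : realType) (P : probability T R).
Variables (X : nat -> {RV P >-> R}) (k : nat).
Hypothesis indepX : mutually_independent X.

(** A pi-system. Because [k] is outside [J], independence from [X k] is mutual independence for the
    index set [J] enlarged by [k]; Dynkin's theorem extends it to the generated sigma-algebra. *)
Definition cylinder : set (set T) := [set A | exists (J : {fset nat}) (B : nat -> set R),
  [/\ k \notin J, forall j, measurable (B j) &
      A = \bigcap_(j in [set` J]) (X j @^-1` B j)]].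

Lemma setI_closed_cylinder : setI_closed cylinder.
Proof.
move=> _ _ [J [B [kJ mB ->]]] [L [C [kL mC ->]]].
exists (J `|` L)%fset, (fun j => (if j \in J then B j else setT) `&`
  (if j \in L then C j else setT)); split.
- by rewrite in_fsetU negb_or kJ.
- by move=> j; apply: measurableI; case: ifP.
apply/seteqP; split=> [w [BJ CL] j /= |w BC]/=.
  by split; case: ifPn => // jJ; [exact: BJ|exact: CL].
split=> j /= jJ; have := BC j; rewrite /= in_fsetU jJ ?orbT => /(_ isT) [] //.
Qed.

(** Measurability is part of the predicate so that the Dynkin argument also shows [others] to be
    coarser than the given sigma-algebra, as [measurable_fun_of_others] requires. *)
Definition independent_of (A : set T) := measurable A /\
  forall B : set R, measurable B -> P (A `&` X k @^-1` B) = (P A * P (X k @^-1` B))%E.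

Let measurable_preRV j (B : set R) : measurable B -> measurable (X j @^-1` B).
Proof. by move=> mB; rewrite -[_ @^-1` _]setTI; exact: measurable_funP. Qed.

Lemma cylinder_independent A : cylinder A -> independent_of A.
Proof.
move=> [J [B [kJ mB ->]]]; split.
  apply: fin_bigcap_measurable => [|j _]; first exact: finite_fset.
  exact: measurable_preRV.
move=> C mC.
pose D j := if j == k then C else B j.
have mD j : measurable (D j) by rewrite /D; case: ifP.
have := indepX (k |` J)%fset mD.
rewrite big_fsetU1//= [D k]/D eqxx.
rewrite (_ : \bigcap_(_ in _) _ = (\bigcap_(j in [set` J]) (X j @^-1` B j)) `&` (X k @^-1` C)).
  move=> ->; rewrite muleC; congr (_ * _)%E.
  rewrite indepX//; apply: eq_big_seq => j jJ.
  by rewrite /D; case: eqP => // jk; rewrite -jk jJ in kJ.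
apply/seteqP; split=> [w XD|w [XB XC] j] /=.
  split=> [j /= jJ|]; last by have := XD k; rewrite /= fset1U1 /D eqxx; exact.
  have := XD j; rewrite /= /D; case: eqP => [jk|_]; first by rewrite -jk jJ in kJ.
  by apply; rewrite fset1Ur.
rewrite in_fset1U => /orP[/eqP ->|jJ]; first by rewrite /D eqxx.
rewrite /D; case: eqP => [jk|_]; first by rewrite -jk jJ in kJ.
exact: XB.
Qed.

Lemma lambda_system_independent : lambda_system setT independent_of.
Proof.
split=> //.
- split=> // B mB.
  by rewrite setTI probability_setT mul1e.
- move=> A B BA [mA iA] [mB iB]; split=> [|C mC]; first exact: measurableD.
  have mXC := measurable_preRV k mC.
  have -> : (A `\` B) `&` X k @^-1` C = (A `&` X k @^-1` C) `\` (B `&` X k @^-1` C).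
    apply/seteqP; split=> [w [[Aw nBw] Xw]|w [[Aw Xw] nBX]]; split=> //.
      by move=> [].
    by split=> // Bw; exact: nBX.
  have fin D : measurable D -> (P D < +oo)%E.
    by move=> mD; rewrite -ge0_fin_numE// fin_num_measure.
  rewrite !measureD ?fin//; [|exact: measurableI..].
  rewrite setIACA setIid (setIidr BA).
  transitivity (P A * P (X k @^-1` C) - P B * P (X k @^-1` C))%E.
    by congr (_ - _)%E; [exact: iA|exact: iB].
  by rewrite muleBl ?fin_num_measure// fin_num_adde_defr ?fin_num_measure.
move=> F ndF FI; have mF i := (FI i).1.
split=> [|C mC]; first exact: bigcup_measurable.
have mXC := measurable_preRV k mC.
rewrite setI_bigcupl.
have c1 : P (F n `&` X k @^-1` C) @[n --> \oo] --> P (\bigcup_n (F n `&` X k @^-1` C)).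
  apply: nondecreasing_cvg_mu => [i||].
  - exact: measurableI.
  - by apply: bigcup_measurable => i _; exact: measurableI.
  - by move=> m n mn; apply/subsetPset; apply: setSI; exact/subsetPset/ndF.
have c2 : (P (F n) * P (X k @^-1` C))%E @[n --> \oo] -->
          (P (\bigcup_n F n) * P (X k @^-1` C))%E.
  apply: cvgeZr; first exact: fin_num_measure.
  apply: nondecreasing_cvg_mu => //; exact: bigcup_measurable.
have eqF : (fun n => P (F n `&` X k @^-1` C)) = (fun n => P (F n) * P (X k @^-1` C))%E.
  by apply/funext => n; exact: (FI n).2.
by rewrite eqF in c1; exact: (cvg_unique _ c1 c2).
Qed.

(* [T] with the sigma-algebra generated by the [X j], [j != k]. *)
Definition others := g_sigma_algebraType cylinder.

Lemma measurable_others (A : set others) : measurable A -> independent_of A.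
Proof.
move=> mA; apply: (lambda_system_subset setI_closed_cylinder
  lambda_system_independent _ _ mA) => //.
exact: cylinder_independent.
Qed.

Lemma measurable_fun_others j : j != k ->
  measurable_fun [set: others] (X j : others -> R).
Proof.
move=> jk _ B mB; rewrite setTI; apply: sub_sigma_algebra.
exists [fset j]%fset, (fun=> B); split=> //.
  by rewrite in_fset1 eq_sym.
by rewrite (_ : [set` _] = [set j]) ?bigcap_set1//; apply/seteqP; split=> i /=; rewrite in_fset1 => /eqP.
Qed.

Lemma measurable_fun_of_others (U : T -> R) :
  measurable_fun [set: others] (U : others -> R) -> measurable_fun setT U.
Proof.
move=> mU _ B mB; have := mU measurableT B mB.
by rewrite setTI => /measurable_others[].
Qed.

Variables (U : T -> R) (h : R -> R).
Hypothesis mU : measurable_fun [set: others] (U : others -> R).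
Hypothesis mh : measurable_fun setT h.
Hypotheses (iU : P.-integrable setT (EFin \o U))
           (ih : P.-integrable setT (EFin \o (h \o X k))).

Let U' : {RV P >-> R} := HB.pack U (isMeasurableFun.Build _ _ _ _ U
   (measurable_fun_of_others mU)).
Let h' : {RV P >-> R} := HB.pack (h \o X k) (isMeasurableFun.Build _ _ _ _ (h \o X k)
   (measurableT_comp mh (measurable_funPT (X k)))).

Let indep_Uh (B C : set R) : measurable B -> measurable C ->
  P (U' @^-1` B `&` h' @^-1` C) = (P (U' @^-1` B) * P (h' @^-1` C))%E.
Proof.
move=> mB mC; rewrite (_ : h' @^-1` C = X k @^-1` (h @^-1` C))//.
apply: (measurable_others _).2; last by rewrite -[_ @^-1` _]setTI; exact: mh.
by rewrite -[_ @^-1` _]setTI; exact: mU.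
Qed.

Lemma integrable_othersM : P.-integrable setT (EFin \o (fun w => U w * h (X k w))).
Proof. exact: (integrable_independentM indep_Uh). Qed.

Lemma Rintegral_othersM :
  \int[P]_w (U w * h (X k w)) = (\int[P]_w U w) * (\int[P]_w h (X k w)).
Proof. exact: (Rintegral_independentM indep_Uh). Qed.

End cylinders.

Section measure_preserving.
Context d d' (T : measurableType d) (T' : measurableType d') (R : realType).
Variables (mu : {measure set T -> \bar R}) (nu : {measure set T' -> \bar R}).
Variables (phi : T -> T') (mphi : measurable_fun setT phi).
Hypothesis phiE : forall A, measurable A -> mu (phi @^-1` A) = nu A.
Variable g : T' -> R.
Hypothesis ig : nu.-integrable setT (EFin \o g).

Lemma integrable_measure_preserving : mu.-integrable setT (EFin \o (g \o phi)).
Proof.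
have mg := measurable_int _ ig.
apply/integrableP; split; first exact: measurableT_comp mg mphi.
have /integrableP[_] := ig; apply: le_lt_trans.
rewrite -(@ge0_integral_pushforward _ _ _ _ _ phi mphi mu setT (fun y => `|(g y)%:E|))%E//.
  by rewrite le_eqVlt; apply/orP; left; apply/eqP/eq_measure_integral => A mA _; exact: phiE.
exact: measurableT_comp mg.
Qed.

Lemma Rintegral_measure_preserving :
  \int[mu]_w g (phi w) = \int[nu]_x g x.
Proof.
rewrite /Rintegral; congr fine.
have mg := measurable_int _ ig.
rewrite -(@integral_pushforward _ _ _ _ _ phi mphi mu setT (EFin \o g))//; last first.
  exact: integrable_measure_preserving.
by apply: eq_measure_integral => A mA _; exact: phiE.
Qed.
End measure_preserving.

Section hybrid.
Context d d' (T : measurableType d) (T' : measurableType d') (R : realType).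
Variables (P : probability T R) (P' : probability T' R).
Variables (Z : nat -> {RV P >-> R}) (Z' : nat -> {RV P' >-> R}).
Hypotheses (indepZ : mutually_independent Z) (indepZ' : mutually_independent Z').

Local Notation PP := (P \x P')%E.

Lemma product_fst A : measurable A -> PP (fst @^-1` A) = P A.
Proof.
move=> mA; rewrite (_ : fst @^-1` A = A `*` setT); last first.
  by apply/seteqP; split=> [w|w []].
transitivity (P A * P' setT)%E; first exact: product_measure1E.
by rewrite probability_setT mule1.
Qed.

Lemma product_snd A : measurable A -> PP (snd @^-1` A) = P' A.
Proof.
move=> mA; rewrite (_ : snd @^-1` A = setT `*` A); last first.
  by apply/seteqP; split=> [w|w []].
transitivity (P setT * P' A)%E; first exact: product_measure1E.
by rewrite probability_setT mul1e.
Qed.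

(* The first [i] variables are replaced. *)
Definition hybrid_fun (i j : nat) (w : T * T') : R :=
  if (j < i)%N then Z' j w.2 else Z j w.1.

Let mhybrid i j : measurable_fun setT (hybrid_fun i j).
Proof. by rewrite /hybrid_fun; case: (j < i)%N; exact: measurableT_comp. Qed.

Definition hybrid i j : {RV PP >-> R} :=
  HB.pack (hybrid_fun i j) (isMeasurableFun.Build _ _ _ _ _ (mhybrid i j)).

(** The event is a rectangle: indices [>= i] constrain the first coordinate only, indices [< i] the
    second, and independence holds on each factor. *)
Lemma hybrid_independent i : mutually_independent (hybrid i).
Proof.
move=> J B mB.
have mZ k : measurable (Z k @^-1` B k).
  by rewrite -[_ @^-1` _]setTI; exact: measurable_funPT.
have mZ' k : measurable (Z' k @^-1` B k).
  by rewrite -[_ @^-1` _]setTI; exact: measurable_funPT.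
pose J1 := [fset j in J | (i <= j)%N]%fset.
pose J2 := [fset j in J | (j < i)%N]%fset.
have -> : \bigcap_(k in [set` J]) hybrid i k @^-1` B k =
   (\bigcap_(k in [set` J1]) Z k @^-1` B k) `*` (\bigcap_(k in [set` J2]) Z' k @^-1` B k).
  apply/seteqP; split=> [[w w'] H|[w w'] [/= H1 H2] j /= jJ].
    split=> j /=; rewrite !inE /= => /andP[jJ ij].
      by have := H j jJ; rewrite /= /hybrid_fun ltnNge ij.
    by have := H j jJ; rewrite /= /hybrid_fun ij.
  rewrite /hybrid_fun; case: ltnP => ij; [apply: H2|apply: H1];
    by rewrite /= !inE /= jJ.
transitivity (P (\bigcap_(k in [set` J1]) Z k @^-1` B k) *
              P' (\bigcap_(k in [set` J2]) Z' k @^-1` B k))%E.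
  by apply: product_measure1E; apply: fin_bigcap_measurable => [|k _] //;
    exact: finite_fset.
have -> : P (\bigcap_(k in [set` J1]) Z k @^-1` B k) = (\prod_(k <- J1) P (Z k @^-1` B k))%E.
  exact: indepZ.
have -> : P' (\bigcap_(k in [set` J2]) Z' k @^-1` B k) = (\prod_(k <- J2) P' (Z' k @^-1` B k))%E.
  exact: indepZ'.
rewrite [RHS](bigID (fun j => i <= j)%N)/=; congr (_ * _)%E.
- rewrite big_fset/=; apply: eq_bigr => k ik.
  rewrite -(product_fst (mZ k)); congr (PP _).
  by apply/funext => w; rewrite /preimage /= /hybrid_fun ltnNge ik.
- rewrite big_fset/= (eq_bigl (fun j => ~~ (i <= j)%N)); last by move=> k; rewrite ltnNge.
  apply: eq_bigr => k ik.
  rewrite -(product_snd (mZ' k)); congr (PP _).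
  by apply/funext => w; rewrite /preimage /= /hybrid_fun ltnNge ik.
Qed.

End hybrid.

(** * Hypercontractivity *)

Section real_integrals.
Context d (T : measurableType d) (R : realType) (P : probability T R).
Implicit Types U V : T -> R.

Definition rintegrable U := P.-integrable setT (EFin \o U).
Local Notation "'E U" := (\int[P]_w U w) (at level 10, U at level 8).

Lemma rintegrableD U V : rintegrable U -> rintegrable V ->
  rintegrable (fun w => U w + V w).
Proof. by move=> iU iV; exact: (integrableD measurableT iU iV). Qed.

Lemma rintegrableZ (c : R) U : rintegrable U -> rintegrable (fun w => c * U w).
Proof. by move=> iU; exact: (integrableZl measurableT c iU). Qed.

Lemma rintegrableB U V : rintegrable U -> rintegrable V ->
  rintegrable (fun w => U w - V w).
Proof. by move=> iU iV; exact: (integrableB measurableT iU iV). Qed.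

Lemma rintegrable_sum I (s : seq I) (F : I -> T -> R) :
  (forall i, rintegrable (F i)) -> rintegrable (fun w => \sum_(i <- s) F i w).
Proof.
move=> iF; rewrite /rintegrable.
rewrite (_ : _ \o _ = (fun w => \sum_(i <- s) (F i w)%:E)%E); last first.
  by apply/funext => w; rewrite /= sumEFin.
by apply: integrable_sum => // i _; exact: iF.
Qed.

Lemma rintegrable_le U V : measurable_fun setT U -> rintegrable V ->
  (forall w, `|U w| <= V w) -> rintegrable U.
Proof.
move=> mU iV UV; apply: le_integrable iV => //; first exact/measurable_EFinP.
by move=> w _ /=; rewrite lee_fin (le_trans (UV w))// ler_norm.
Qed.

Lemma ERD U V : rintegrable U -> rintegrable V ->
  'E (fun w => U w + V w) = 'E U + 'E V.
Proof. by move=> iU iV; exact: RintegralD. Qed.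

Lemma ERZ (c : R) U : rintegrable U -> 'E (fun w => c * U w) = c * 'E U.
Proof. by move=> iU; exact: RintegralZl. Qed.

Lemma ER_le U V : rintegrable U -> rintegrable V -> (forall w, U w <= V w) -> 'E U <= 'E V.
Proof. by move=> iU iV UV; exact: le_Rintegral. Qed.

Lemma rintegrable_cst (c : R) : rintegrable (fun=> c).
Proof. exact: finite_measure_integrable_cst. Qed.

Lemma ER_cst (c : R) : 'E (fun=> c) = c.
Proof.
rewrite Rintegral_cst// -[RHS]mulr1; congr (_ * _).
by rewrite -[RHS]/(fine 1%E); congr fine; exact: probability_setT.
Qed.

Lemma ER_sum I (s : seq I) (F : I -> T -> R) :
  (forall i, rintegrable (F i)) -> 'E (fun w => \sum_(i <- s) F i w) = \sum_(i <- s) 'E (F i).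
Proof.
move=> iF; elim: s => [|i s IH].
  by rewrite big_nil; under eq_Rintegral do rewrite big_nil; rewrite ER_cst.
rewrite big_cons -IH -ERD//; last exact: rintegrable_sum.
by apply: eq_Rintegral => w _; rewrite big_cons.
Qed.

Lemma ER_norm U : rintegrable U -> `|'E U| <= 'E (fun w => `|U w|).
Proof. by move=> iU; exact: le_normr_Rintegral. Qed.
End real_integrals.

Section scalar.
Context (R : realType).
Implicit Types a u x y U V mu : R.

(* The term of order 1 is kept with its sign, so that it vanishes in expectation
   for a centered independent [u]. *)
Lemma cube_normD_le a u :
  `|a + u| ^+ 3 <= `|a| ^+ 3 + 3 * (a * `|a|) * u + 3 * `|a| * u ^+ 2 + `|u| ^+ 3.
Proof.
have q1 : 0 <= a ^+ 2 + 3 * a * u + 3 * u ^+ 2.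
  have -> : a ^+ 2 + 3 * a * u + 3 * u ^+ 2 = (a + 3 / 2 * u) ^+ 2 + 3 / 4 * u ^+ 2 by field.
  by apply: addr_ge0; [exact: sqr_ge0|apply: mulr_ge0; [lra|exact: sqr_ge0]].
have pa : 0 <= `|a| * (a ^+ 2 + 3 * a * u + 3 * u ^+ 2) by rewrite mulr_ge0.
have pu : 0 <= `|u| ^+ 3 by rewrite exprn_ge0.
case: (lerP 0 a) => a0; case: (lerP 0 u) => u0; case: (lerP 0 (a + u)) => au;
  move: pa pu; rewrite ?(ger0_norm a0) ?(ltr0_norm a0) ?(ger0_norm u0) ?(ltr0_norm u0)
    ?(ger0_norm au) ?(ltr0_norm au) => pa pu; lra.
Qed.

(** Weighted AM-GM, with equality at [x = U], [y = V]. When [U], [V] majorize the [L^3] norms of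
    [A], [B], integration gives [E |A| B^2 <= U V^2], that is, Hoelder's inequality. [young4] does
    the same for [E A^2 B^2]. *)
Lemma young3 x y U V : 0 <= x -> 0 <= y -> 0 < U -> 0 < V ->
  x * y ^+ 2 <= V ^+ 2 / (3 * U ^+ 2) * x ^+ 3 + 2 * U / (3 * V) * y ^+ 3.
Proof.
move=> x0 y0 U0 V0.
have am (s t : R) : 0 <= s -> 0 <= t -> 3 * (s * t ^+ 2) <= s ^+ 3 + 2 * t ^+ 3.
  move=> s0 t0; rewrite -subr_ge0.
  have -> : s ^+ 3 + 2 * t ^+ 3 - 3 * (s * t ^+ 2) = (s - t) ^+ 2 * (s + 2 * t) by ring.
  by rewrite mulr_ge0 ?sqr_ge0// addr_ge0// mulr_ge0.
have := am (x / U) (y / V); rewrite !divr_ge0 ?(ltW U0) ?(ltW V0)// => /(_ isT isT) H.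
have UV : 0 < U * V ^+ 2 / 3 by rewrite divr_gt0// mulr_gt0// exprn_gt0.
rewrite -(ler_pM2l UV) in H.
have -> : x * y ^+ 2 = U * V ^+ 2 / 3 * (3 * (x / U * (y / V) ^+ 2)).
  by field; rewrite !gt_eqF.
apply: (le_trans H); rewrite le_eqVlt; apply/orP; left; apply/eqP.
by field; rewrite !gt_eqF.
Qed.

Lemma young4 x y U V : 0 < U -> 0 < V ->
  x ^+ 2 * y ^+ 2 <= V ^+ 2 / (2 * U ^+ 2) * x ^+ 4 + U ^+ 2 / (2 * V ^+ 2) * y ^+ 4.
Proof.
move=> U0 V0; set c := V / U; have c0 : c != 0 by rewrite gt_eqF// divr_gt0.
rewrite -subr_ge0.
have -> : V ^+ 2 / (2 * U ^+ 2) * x ^+ 4 + U ^+ 2 / (2 * V ^+ 2) * y ^+ 4 - x ^+ 2 * y ^+ 2 =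
   (c * x ^+ 2 - c^-1 * y ^+ 2) ^+ 2 / 2.
  by rewrite /c; field; rewrite !gt_eqF.
by rewrite divr_ge0 ?sqr_ge0.
Qed.

Lemma hyper3_scalar U V mu : 1 <= mu -> 0 <= U -> 0 <= V ->
  U ^+ 3 + 3 * (U * V ^+ 2) + mu * V ^+ 3 <= Num.sqrt (U ^+ 2 + 7 / 3 * mu * V ^+ 2) ^+ 3.
Proof.
move=> mu1 U0 V0.
have W0 : 0 <= U ^+ 2 + 7 / 3 * mu * V ^+ 2.
  by rewrite addr_ge0 ?sqr_ge0// mulr_ge0 ?sqr_ge0//; lra.
rewrite -(@ler_pXn2r _ 2)// ?nnegrE; last 2 first.
- by rewrite !addr_ge0// !mulr_ge0 ?exprn_ge0//; lra.
- by rewrite exprn_ge0// sqrtr_ge0.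
rewrite -exprM mulnC exprM sqr_sqrtr//.
rewrite -subr_ge0.
(* The negative terms in [U ^+ 3 * V ^+ 3] and [U * V ^+ 5] are completed by the first two squares.
   The first square takes [mu] out of the coefficient [7 * mu - 6] of [U ^+ 4 * V ^+ 2]; that
   [6 * (mu - 1)] remains is the reason for [7 / 3]. *)
have -> : (U ^+ 2 + 7 / 3 * mu * V ^+ 2) ^+ 3 - (U ^+ 3 + 3 * (U * V ^+ 2) + mu * V ^+ 3) ^+ 2 =
  mu * (U * V * (U - V)) ^+ 2 + 3 * mu * (V ^+ 2 * (U - V)) ^+ 2 +
  6 * (mu - 1) * (U ^+ 2 * V) ^+ 2 + (49 / 3 * mu ^+ 2 - 4 * mu - 9) * (U * V ^+ 2) ^+ 2 +
  mu * (343 / 27 * mu ^+ 2 - mu - 3) * (V ^+ 3) ^+ 2.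
  by field.
have mu2 : mu <= mu ^+ 2 by rewrite expr2 ler_peMl//; lra.
do ![apply: addr_ge0]; apply: (mulr_ge0 _ (sqr_ge0 _)); try lra.
by apply: mulr_ge0; lra.
Qed.

(** The cross term asks for [2 * (3 * mu) >= 6], an equality at [mu = 1], where no factor smaller
    than [3] would do. *)
Lemma hyper4_scalar U V mu : 1 <= mu ->
  U ^+ 4 + 6 * (U ^+ 2 * V ^+ 2) + mu * V ^+ 4 <= Num.sqrt (U ^+ 2 + 3 * mu * V ^+ 2) ^+ 4.
Proof.
move=> mu1.
have W0 : 0 <= U ^+ 2 + 3 * mu * V ^+ 2.
  by rewrite addr_ge0 ?sqr_ge0// mulr_ge0 ?sqr_ge0//; lra.
rewrite [Num.sqrt _ ^+ 4](exprM _ 2 2) sqr_sqrtr//.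
have := sqr_ge0 V; have := sqr_ge0 U.
rewrite !(exprM _ 2 2); set u := U ^+ 2; set v := V ^+ 2 => u0 v0.
have uv : 0 <= u * v by rewrite mulr_ge0.
have vv : 0 <= v ^+ 2 by rewrite sqr_ge0.
have : 0 <= (mu - 1) * (u * v) by rewrite mulr_ge0// subr_ge0.
have : 0 <= mu * (9 * mu - 1) * v ^+ 2 by apply: mulr_ge0 vv; apply: mulr_ge0; lra.
by lra.
Qed.

End scalar.

Section multilinear.
Context (R : realType) (n : nat).
Implicit Types (q : {set 'I_n} -> R) (z : nat -> R) (k : 'I_n).

Definition mlpoly q z : R := \sum_(A : {set 'I_n}) q A * \prod_(i in A) z i.
(** With [diff_part]: the coefficients of the polynomial at [z k = 0] and of its derivative in
    [z k]. Both are extended by zero to the sets containing [k], so that the number of variables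
    never changes. *)
Definition const_part k q (A : {set 'I_n}) := if k \in A then 0 else q A.
Definition diff_part k q (A : {set 'I_n}) := if k \in A then 0 else q (k |: A).
(** For independent centered variables of variance one, the squared [L^2] norm of the polynomial
    after scaling each variable by the square root of [K]. *)
Definition wnorm (K : R) q : R := \sum_(A : {set 'I_n}) K ^+ #|A| * q A ^+ 2.

Lemma big_setU1_reindex k (F : {set 'I_n} -> R) :
  \sum_(A : {set 'I_n} | k \in A) F A = \sum_(A : {set 'I_n} | k \notin A) F (k |: A).
Proof.
rewrite (reindex_onto (fun A => k |: A) (fun A => A :\ k)) /=; last by move=> A; exact: finset.setD1K.
apply: eq_bigl => A; rewrite finset.setU11 /=.
by apply/eqP/idP => [<-|kA]; [rewrite finset.setD11|rewrite finset.setU1K].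
Qed.

Lemma mlpoly_split k q z :
  mlpoly q z = mlpoly (const_part k q) z + z k * mlpoly (diff_part k q) z.
Proof.
rewrite /mlpoly (bigID (fun A : {set 'I_n} => k \in A))/= addrC; congr (_ + _).
  rewrite [RHS](bigID (fun A : {set 'I_n} => k \in A))/= [X in _ = X + _]big1 ?add0r => [|A kA].
    by apply: eq_bigr => A kA; rewrite /const_part (negPf kA).
  by rewrite /const_part kA mul0r.
rewrite big_setU1_reindex [in RHS](bigID (fun A : {set 'I_n} => k \in A))/=.
rewrite [X in z k * (X + _)]big1 ?add0r => [|A kA]; last by rewrite /diff_part kA mul0r.
rewrite big_distrr/=; apply: eq_bigr => A kA.
by rewrite /diff_part (negPf kA) big_setU1//= mulrCA.
Qed.

Lemma wnorm_split K k q :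
  wnorm K q = wnorm K (const_part k q) + K * wnorm K (diff_part k q).
Proof.
rewrite /wnorm (bigID (fun A : {set 'I_n} => k \in A))/= addrC; congr (_ + _).
  rewrite [RHS](bigID (fun A : {set 'I_n} => k \in A))/= [X in _ = X + _]big1 ?add0r => [|A kA].
    by apply: eq_bigr => A kA; rewrite /const_part (negPf kA).
  by rewrite /const_part kA expr0n mulr0.
rewrite big_setU1_reindex [in RHS](bigID (fun A : {set 'I_n} => k \in A))/=.
rewrite [X in K * (X + _)]big1 ?add0r => [|A kA]; last by rewrite /diff_part kA expr0n mulr0.
rewrite big_distrr/=; apply: eq_bigr => A kA.
by rewrite /diff_part (negPf kA) cardsU1 kA exprD expr1 mulrA.
Qed.

Lemma eq_mlpoly k q z z' : (forall A : {set 'I_n}, k \in A -> q A = 0) ->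
  (forall j, j != k :> nat -> z j = z' j) -> mlpoly q z = mlpoly q z'.
Proof.
move=> q0 zz'; apply: eq_bigr => A _; have [kA|kA] := boolP (k \in A).
  by rewrite q0// !mul0r.
congr (_ * _); apply: eq_bigr => i iA; apply: zz'.
by apply: contra kA => /eqP/val_inj <-.
Qed.

Lemma const_part0 k q (A : {set 'I_n}) : k \in A -> const_part k q A = 0.
Proof. by rewrite /const_part => ->. Qed.

Lemma diff_part0 k q (A : {set 'I_n}) : k \in A -> diff_part k q A = 0.
Proof. by rewrite /diff_part => ->. Qed.

End multilinear.

Section multilinear_others.
Context d (T : measurableType d) (R : realType) (P : probability T R).
Context (X : nat -> {RV P >-> R}) (n : nat).

Lemma measurable_mlpoly d' (T' : measurableType d') (x : nat -> T' -> R)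
    (q : {set 'I_n} -> R) :
  (forall (A : {set 'I_n}) i, i \in A -> q A != 0 -> measurable_fun setT (x (nat_of_ord i))) ->
  measurable_fun setT (fun w => mlpoly q (x ^~ w)).
Proof.
move=> mx; apply: measurable_sum => A.
have [q0|q0] := eqVneq (q A) 0.
  by under eq_fun do rewrite q0 mul0r; exact: measurable_cst.
apply: measurable_funM => //.
rewrite (_ : (fun _ => _) = fun w => \prod_(i <- enum A) x i w); last first.
  by apply/funext => w; rewrite big_enum.
have : {in enum A, forall i : 'I_n, measurable_fun setT (x i)}.
  by move=> i; rewrite mem_enum => iA; exact: mx iA q0.
elim: (enum A) => [|i s IH] ms.
  by under eq_fun do rewrite big_nil; exact: measurable_cst.
under eq_fun do rewrite big_cons.
apply: measurable_funM; first by apply: ms; rewrite mem_head.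
by apply: IH => j js; apply: ms; rewrite in_cons js orbT.
Qed.

Lemma measurable_mlpoly_others (k : 'I_n) (q : {set 'I_n} -> R) :
  (forall A : {set 'I_n}, k \in A -> q A = 0) ->
  measurable_fun [set: others X k] (fun w : others X k => mlpoly q (fun j => X j w)).
Proof.
move=> q0; apply: measurable_mlpoly => A i iA qA.
apply: measurable_fun_others; apply: contra qA => /eqP/val_inj ik.
by rewrite q0// -ik.
Qed.
End multilinear_others.

Lemma le_expn_lim (R : realType) (p : nat) (x u : R) : (0 < p)%N -> 0 <= u ->
  (forall U : R, u < U -> x <= U ^+ p) -> x <= u ^+ p.
Proof.
move=> p0 u0 H; rewrite leNgt; apply/negP => xu.
pose y := (x + u ^+ p) / 2.
have uy : u ^+ p < y by rewrite /y; lra.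
have yx : y < x by rewrite /y; lra.
have y0 : 0 < y by apply: le_lt_trans uy; rewrite exprn_ge0.
have yE : (y `^ p%:R^-1) ^+ p = y.
  by rewrite -powR_mulrn ?powR_ge0// -powRrM mulVf ?powRr1 ?ltW// pnatr_eq0 -lt0n.
suff : x <= (y `^ p%:R^-1) ^+ p by rewrite yE leNgt yx.
by apply: H; rewrite -(@ltr_pXn2r _ p)// ?nnegrE ?powR_ge0// yE.
Qed.

Section hypercontractivity.
Context d (T : measurableType d) (R : realType) (P : probability T R).
Context (X : nat -> {RV P >-> R}) (p : nat) (K : R).
Hypothesis K0 : 0 < K.
Hypothesis p0 : (0 < p)%N.
Local Notation "'E U" := (\int[P]_w U w) (at level 10, U at level 8).

(** The one-variable inequality that tensorizes: [A] and [B] stand for polynomials in the other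
    variables. Integrability is carried along because the next variable needs it. *)
Definition contractive_step := forall (k : nat) (A B : T -> R),
  measurable_fun [set: others X k] (A : others X k -> R) ->
  measurable_fun [set: others X k] (B : others X k -> R) ->
  rintegrable P (fun w => `|A w| ^+ p) -> rintegrable P (fun w => `|B w| ^+ p) ->
  rintegrable P (fun w => `|A w + X k w * B w| ^+ p) /\
  forall U V : R, 0 < U -> 0 < V ->
  'E (fun w => `|A w| ^+ p) <= U ^+ p -> 'E (fun w => `|B w| ^+ p) <= V ^+ p ->
  'E (fun w => `|A w + X k w * B w| ^+ p) <= Num.sqrt (U ^+ 2 + K * V ^+ 2) ^+ p.

Hypothesis step : contractive_step.

(* Bounds that are strict and positive, because [young3] and [young4] divide by
   [U] and [V]; the weak form is recovered by a limit. *)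
Let hyper_seq n (s : seq 'I_n) (q : {set 'I_n} -> R) :
  (forall A, q A != 0 -> A \subset [set i in s]) ->
  rintegrable P (fun w => `|mlpoly q (X ^~ w)| ^+ p) /\
  forall U : R, 0 < U -> wnorm K q < U ^+ 2 ->
  'E (fun w => `|mlpoly q (X ^~ w)| ^+ p) <= U ^+ p.
Proof.
elim: s q => [|k s IH] q qs.
  have q0 (A : {set 'I_n}) : A != finset.set0 -> q A = 0.
    apply: contraNeq => /qs /fintype.subsetP sA; rewrite -finset.subset0.
    by apply/fintype.subsetP => x /sA; rewrite !inE.
  have QE z : mlpoly q z = q finset.set0.
    rewrite /mlpoly (bigD1 finset.set0)//= big_set0 mulr1 big1 ?addr0// => A A0.
    by rewrite q0// mul0r.
  have WE : wnorm K q = q finset.set0 ^+ 2.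
    rewrite /wnorm (bigD1 finset.set0)//= cards0 expr0 mul1r big1 ?addr0// => A A0.
    by rewrite q0// expr0n mulr0.
  rewrite (_ : (fun _ => _) = (fun=> `|q finset.set0| ^+ p)); last first.
    by apply/funext => w; rewrite QE.
  split=> [|U U0]; first exact: rintegrable_cst.
  rewrite ER_cst WE => qU; rewrite ler_pXn2r// ?nnegrE ?ltW//.
  by rewrite -(@ltr_pXn2r _ 2)// ?nnegrE ?ltW// real_normK// num_real.
have [|i0 H0] := IH (const_part k q).
  move=> A; rewrite /const_part; case: ifPn; rewrite ?eqxx// => kA /qs.
  move=> /fintype.subsetP H; apply/fintype.subsetP => x xA; have := H x xA.
  by rewrite !inE => /predU1P[xk|//]; rewrite -xk xA in kA.
have [|i1 H1] := IH (diff_part k q).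
  move=> A; rewrite /diff_part; case: ifPn; rewrite ?eqxx// => kA /qs.
  move=> /fintype.subsetP H; apply/fintype.subsetP => x xA; have := H x.
  rewrite !inE xA orbT => /(_ isT) /predU1P[xk|//]; by rewrite -xk xA in kA.
have m0 := @measurable_mlpoly_others _ _ _ _ X _ _ _ (@const_part0 _ _ k q).
have m1 := @measurable_mlpoly_others _ _ _ _ X _ _ _ (@diff_part0 _ _ k q).
have [iS Hs] := step m0 m1 i0 i1.
have QE : (fun w => `|mlpoly q (X ^~ w)| ^+ p) =
  (fun w => `|mlpoly (const_part k q) (X ^~ w) + X k w * mlpoly (diff_part k q) (X ^~ w)| ^+ p).
  by apply/funext => w; rewrite (mlpoly_split k).
rewrite QE; split=> // U U0; rewrite (wnorm_split _ k) => W.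
have w0 : 0 <= wnorm K (const_part k q).
  by apply: sumr_ge0 => A _; rewrite mulr_ge0 ?sqr_ge0 ?exprn_ge0 ?ltW.
have w1 : 0 <= wnorm K (diff_part k q).
  by apply: sumr_ge0 => A _; rewrite mulr_ge0 ?sqr_ge0 ?exprn_ge0 ?ltW.
move: W H0 H1 w0 w1; set W0 := wnorm K _; set W1 := wnorm K _ => W H0 H1 w0 w1.
pose e := U ^+ 2 - (W0 + K * W1).
(* The slack [e] is shared between the two parts so that the new majorants combine to [U ^+ 2]
   exactly. *)
have e0 : 0 < e by rewrite subr_gt0.
pose U0' := W0 + e / 2; pose V0' := W1 + e / (2 * K).
have U0p : 0 < U0' by rewrite ltr_wpDl// divr_gt0.
have V0p : 0 < V0' by rewrite ltr_wpDl// divr_gt0// mulr_gt0.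
have := Hs (Num.sqrt U0') (Num.sqrt V0'); rewrite !sqrtr_gt0 => /(_ U0p V0p).
rewrite !sqr_sqrtr ?(ltW U0p) ?(ltW V0p)//.
have -> : U0' + K * V0' = U ^+ 2 by rewrite /U0' /V0' /e; field; rewrite gt_eqF.
rewrite sqrtr_sqr gtr0_norm//; apply.
- by apply: H0; rewrite ?sqrtr_gt0// sqr_sqrtr ?(ltW U0p)// /U0' ltrDl divr_gt0.
- by apply: H1; rewrite ?sqrtr_gt0// sqr_sqrtr ?(ltW V0p)// /V0' ltrDl divr_gt0// mulr_gt0.
Qed.

Lemma hypercontractivity n (q : {set 'I_n} -> R) :
  rintegrable P (fun w => `|mlpoly q (X ^~ w)| ^+ p) /\
  'E (fun w => `|mlpoly q (X ^~ w)| ^+ p) <= Num.sqrt (wnorm K q) ^+ p.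
Proof.
have [|i H] := @hyper_seq n (enum 'I_n) q.
  by move=> A _; apply/fintype.subsetP => x _; rewrite inE mem_enum.
split=> //; apply: le_expn_lim => // U sU.
have U0 : 0 < U by apply: le_lt_trans sU; exact: sqrtr_ge0.
apply: H => //; rewrite -(@sqr_sqrtr _ (wnorm K q)).
  by rewrite ltr_pXn2r// ?nnegrE ?sqrtr_ge0// ltW.
by apply: sumr_ge0 => A _; rewrite mulr_ge0 ?sqr_ge0 ?exprn_ge0 ?ltW.
Qed.

End hypercontractivity.

Lemma expr_mixed_le (R : realType) (x y : R) (i j : nat) : 0 <= x -> 0 <= y ->
  x ^+ i * y ^+ j <= x ^+ (i + j) + y ^+ (i + j).
Proof.
move=> x0 y0; have [xy|yx] := leP x y.
  apply: (@le_trans _ _ (y ^+ i * y ^+ j)).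
    by rewrite ler_wpM2r ?exprn_ge0// lerXn2r ?nnegrE.
  by rewrite -exprD lerDr exprn_ge0.
apply: (@le_trans _ _ (x ^+ i * x ^+ j)).
  by rewrite ler_wpM2l ?exprn_ge0// lerXn2r ?nnegrE// ltW.
by rewrite -exprD lerDl exprn_ge0.
Qed.

Section steps.
Context d (T : measurableType d) (R : realType) (P : probability T R).
Context (X : nat -> {RV P >-> R}) (mu : R).
Hypothesis indepX : mutually_independent X.
Hypothesis iX1 : forall k, rintegrable P (X k).
Hypothesis iX2 : forall k, rintegrable P (fun w => X k w ^+ 2).
Hypothesis mean0 : forall k, \int[P]_w X k w = 0.
Hypothesis var1 : forall k, \int[P]_w (X k w ^+ 2) = 1.
Hypothesis mu1 : 1 <= mu.
Local Notation "'E U" := (\int[P]_w U w) (at level 10, U at level 8).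

(** Integrating [cube_normD_le], the linear term vanishes by centering and the quadratic one sees
    only the variance; [young3] then leads to the left-hand side of [hyper3_scalar]. *)
Lemma contractive_step3 :
  (forall k, rintegrable P (fun w => `|X k w| ^+ 3)) ->
  (forall k, 'E (fun w => `|X k w| ^+ 3) <= mu) ->
  contractive_step X 3 (7 / 3 * mu).
Proof.
move=> iX3 moment k A B mA mB iA iB.
have mA' := measurable_fun_of_others indepX mA; have mB' := measurable_fun_of_others indepX mB.
have mAB : measurable_fun [set: others X k] (fun w : others X k => 3 * (A w * `|A w|) * B w).
  by do ?apply: measurable_funM => //; exact: measurableT_comp.
have mAB2 : measurable_fun [set: others X k] (fun w : others X k => 3 * `|A w| * B w ^+ 2).
  apply: measurable_funM; last exact: measurable_funX.
  by apply: measurable_funM => //; exact: measurableT_comp.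
have iAB3 : rintegrable P (fun w => 3 * (`|A w| ^+ 3 + `|B w| ^+ 3)).
  by apply: rintegrableZ; exact: rintegrableD.
have iAB : rintegrable P (fun w => 3 * (A w * `|A w|) * B w).
  apply: rintegrable_le iAB3 _; first exact: (measurable_fun_of_others indepX mAB).
  move=> w; rewrite !normrM normr_id gtr0_norm// -mulrA ler_wpM2l//.
  by rewrite -expr2 -[X in _ * X]expr1 expr_mixed_le.
have iAB2 : rintegrable P (fun w => 3 * `|A w| * B w ^+ 2).
  apply: rintegrable_le iAB3 _; first exact: (measurable_fun_of_others indepX mAB2).
  move=> w; rewrite !normrM normr_id gtr0_norm// -mulrA ler_wpM2l// -expr2.
  by rewrite -[X in X * _]expr1 expr_mixed_le.
have mB3 : measurable_fun [set: others X k] (fun w : others X k => `|B w| ^+ 3).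
  by apply: measurable_funX; exact: measurableT_comp.
have m3 : measurable_fun setT (fun x : R => `|x| ^+ 3).
  by apply: measurable_funX.
have m2 : measurable_fun setT (fun x : R => x ^+ 2) by exact: measurable_funX.
have m1 : measurable_fun setT (fun x : R => x) by [].
have j1 := integrable_othersM indepX mAB m1 iAB (iX1 k).
have j2 := integrable_othersM indepX mAB2 m2 iAB2 (iX2 k).
have j3 := integrable_othersM indepX mB3 m3 iB (iX3 k).
have e1 := Rintegral_othersM indepX mAB m1 iAB (iX1 k).
have e2 := Rintegral_othersM indepX mAB2 m2 iAB2 (iX2 k).
have e3 := Rintegral_othersM indepX mB3 m3 iB (iX3 k).
rewrite mean0 mulr0 in e1; rewrite var1 mulr1 in e2.
pose S w := `|A w| ^+ 3 + 3 * (A w * `|A w|) * B w * X k w +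
   3 * `|A w| * B w ^+ 2 * X k w ^+ 2 + `|B w| ^+ 3 * `|X k w| ^+ 3.
have iS : rintegrable P S by do ![apply: rintegrableD].
have le_S w : `|A w + X k w * B w| ^+ 3 <= S w.
  apply: le_trans (cube_normD_le _ _) _; rewrite /S normrM exprMn.
  by rewrite le_eqVlt; apply/orP; left; apply/eqP; ring.
have mS : measurable_fun setT (fun w => `|A w + X k w * B w| ^+ 3).
  apply: measurable_funX; apply: measurableT_comp => //.
  by apply: measurable_funD => //; exact: measurable_funM.
have iG : rintegrable P (fun w => `|A w + X k w * B w| ^+ 3).
  by apply: rintegrable_le iS _ => // w; rewrite normrX normr_id.
split=> // U V U0 V0 AU BV.
apply: le_trans (hyper3_scalar mu1 (ltW U0) (ltW V0)).
apply: (@le_trans _ _ ('E S)); first exact: ER_le.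
rewrite /S !ERD//; [|by do ?[apply: rintegrableD]..].
rewrite e1 e2 e3 addr0; apply: lerD; first apply: lerD => //.
  have iAB2' : rintegrable P (fun w => V ^+ 2 / (3 * U ^+ 2) * `|A w| ^+ 3 +
      2 * U / (3 * V) * `|B w| ^+ 3).
    by apply: rintegrableD; exact: rintegrableZ.
  apply: (@le_trans _ _ ('E (fun w => 3 * (V ^+ 2 / (3 * U ^+ 2) * `|A w| ^+ 3 +
      2 * U / (3 * V) * `|B w| ^+ 3)))).
    apply: ER_le => //; first exact: rintegrableZ.
    move=> w; rewrite -mulrA ler_wpM2l// -[B w ^+ 2]real_normK ?num_real//.
    exact: young3.
  rewrite ERZ// ERD; [|exact: rintegrableZ..]; rewrite !ERZ// ler_wpM2l//.
  have -> : U * V ^+ 2 = V ^+ 2 / (3 * U ^+ 2) * U ^+ 3 + 2 * U / (3 * V) * V ^+ 3.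
    by field; rewrite !gt_eqF.
  by apply: lerD; rewrite ler_wpM2l// divr_ge0 ?mulr_ge0 ?sqr_ge0// ltW.
rewrite [mu * _]mulrC; apply: ler_pM => //.
  by apply: Rintegral_ge0 => w _; exact: exprn_ge0.
by apply: Rintegral_ge0 => w _; exact: exprn_ge0.
Qed.

(** In the binomial expansion orders 1 and 3 integrate to zero; orders 0, 2 and 4 give the left-hand
    side of [hyper4_scalar]. *)
Lemma contractive_step4 :
  (forall k, rintegrable P (fun w => X k w ^+ 3)) ->
  (forall k, 'E (fun w => X k w ^+ 3) = 0) ->
  (forall k, rintegrable P (fun w => `|X k w| ^+ 4)) ->
  (forall k, 'E (fun w => `|X k w| ^+ 4) <= mu) ->
  contractive_step X 4 (3 * mu).
Proof.
move=> iX3 skew0 iX4 moment k A B mA mB iA iB.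
have even4 (x : R) : `|x| ^+ 4 = x ^+ 4.
  by rewrite !(exprM _ 2 2) real_normK// num_real.
have mA' := measurable_fun_of_others indepX mA; have mB' := measurable_fun_of_others indepX mB.
have mm i j : measurable_fun [set: others X k]
    (fun w : others X k => 'C(4, j)%:R * (A w ^+ i * B w ^+ j)).
  by apply: measurable_funM => //; apply: measurable_funM; exact: measurable_funX.
have ii i j : (i + j = 4)%N ->
    rintegrable P (fun w => 'C(4, j)%:R * (A w ^+ i * B w ^+ j)).
  move=> ij; apply: rintegrableZ.
  apply: rintegrable_le (rintegrableD iA iB) _.
    by apply: measurable_funM; exact: measurable_funX.
  by move=> w; rewrite normrM !normrX -ij; exact: expr_mixed_le.
have iX j : (j <= 4)%N -> rintegrable P (fun w => X k w ^+ j).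
  case: j => [_|[_|[_|[_|[_|//]]]]] //; first exact: rintegrable_cst.
    exact: iX1.
  by have := iX4 k; congr rintegrable; apply/funext => w; rewrite even4.
have mj j : measurable_fun setT (fun x : R => x ^+ j) by exact: measurable_funX.
have jj (j : 'I_5) := integrable_othersM indepX (mm (4 - j)%N j) (mj j)
  (ii _ _ (subnK (ltn_ord j : (j <= 4)%N))) (iX j (ltn_ord j)).
have ee (j : 'I_5) := Rintegral_othersM indepX (mm (4 - j)%N j) (mj j)
  (ii _ _ (subnK (ltn_ord j : (j <= 4)%N))) (iX j (ltn_ord j)).
have GE : (fun w => `|A w + X k w * B w| ^+ 4) =
  (fun w => \sum_(j < 5) 'C(4, j)%:R * (A w ^+ (4 - j) * B w ^+ j) * X k w ^+ j).
  apply/funext => w; rewrite even4 exprDn; apply: eq_bigr => j _.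
  by rewrite exprMn -mulr_natl; ring.
rewrite GE; split=> [|U V U0 V0 AU BV]; first exact: rintegrable_sum.
apply: le_trans (hyper4_scalar U V mu1).
rewrite ER_sum// (eq_bigr _ (fun j _ => ee j)).
rewrite -(big_mkord xpredT (fun j =>
  \int[P]_w ('C(4, j)%:R * (A w ^+ (4 - j) * B w ^+ j)) * \int[P]_w (X k w ^+ j))).
rewrite /index_iota /= !big_cons big_nil skew0 var1.
have -> : \int[P]_w (X k w ^+ 1) = 0 by exact: mean0.
have -> : \int[P]_w (X k w ^+ 0) = 1 by exact: ER_cst.
rewrite !mulr0 !mulr1 !add0r addr0 addrA; apply: lerD; first apply: lerD.
- apply: le_trans AU; rewrite le_eqVlt; apply/orP; left; apply/eqP.
  by apply: eq_Rintegral => w _; rewrite even4 expr0 mulr1 bin0 mul1r.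
- have iAB' : rintegrable P (fun w => V ^+ 2 / (2 * U ^+ 2) * `|A w| ^+ 4 +
      U ^+ 2 / (2 * V ^+ 2) * `|B w| ^+ 4).
    by apply: rintegrableD; exact: rintegrableZ.
  apply: (@le_trans _ _ ('E (fun w => 6 * (V ^+ 2 / (2 * U ^+ 2) * `|A w| ^+ 4 +
      U ^+ 2 / (2 * V ^+ 2) * `|B w| ^+ 4)))).
    apply: ER_le; [exact: ii|exact: rintegrableZ|].
    by move=> w; rewrite ler_wpM2l// !even4; exact: young4.
  rewrite ERZ// ERD; [|exact: rintegrableZ..]; rewrite !ERZ// ler_wpM2l//.
  have -> : U ^+ 2 * V ^+ 2 = V ^+ 2 / (2 * U ^+ 2) * U ^+ 4 + U ^+ 2 / (2 * V ^+ 2) * V ^+ 4.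
    by field; rewrite !gt_eqF.
  by apply: lerD; rewrite ler_wpM2l// divr_ge0 ?sqr_ge0// mulr_ge0 ?sqr_ge0.
rewrite [mu * _]mulrC; apply: ler_pM => //.
- by apply: Rintegral_ge0 => w _; rewrite binn mul1r expr0 mul1r -even4 exprn_ge0.
- by apply: Rintegral_ge0 => w _; rewrite -even4 exprn_ge0.
- apply: le_trans BV; rewrite le_eqVlt; apply/orP; left; apply/eqP.
  by apply: eq_Rintegral => w _; rewrite even4 expr0 mul1r binn mul1r.
- apply: le_trans (moment k); rewrite le_eqVlt; apply/orP; left; apply/eqP.
  by apply: eq_Rintegral => w _; rewrite even4.
Qed.

End steps.

(** * Lindeberg's replacement argument *)

Section taylor.
Context (R : realType).
Implicit Types f h : R -> R.

Lemma le_pow_of_derive h (dh : R -> R) (C u : R) (n : nat) :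
  (forall t : R, is_derive t 1 h (dh t)) -> h 0 = 0 ->
  (forall t, 0 <= t -> dh t <= C * t ^+ n) -> 0 <= u ->
  h u <= C / n.+1%:R * u ^+ n.+1.
Proof.
move=> hd h0 hC u0.
pose q : {poly R} := (C / n.+1%:R) *: 'X^(n.+1).
have qE t : q.[t] = C / n.+1%:R * t ^+ n.+1 by rewrite !hornerE.
have q'E t : q^`().[t] = C * t ^+ n.
  by rewrite derivZ derivXn hornerZ hornerMn hornerXn /= -[t ^+ n *+ _]mulr_natl mulrA divfK// pnatr_eq0.
have dk (t : R) : is_derive t 1 (h \- horner q) (dh t - q^`().[t]).
  exact: is_deriveB.
have [|c c0u] := @MVT_segment R (h \- horner q) (fun t => dh t - q^`().[t]) 0 u u0 (fun t _ => dk t).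
  apply: continuous_subspaceT => t; apply/differentiable_continuous/derivable1_diffP.
  by case: (dk t).
rewrite /= h0 !qE expr0n/= mulr0 !subr0 q'E => /eqP; rewrite subr_eq => /eqP ->.
rewrite gerDr mulr_le0_ge0// subr_le0 hC//.
by move: c0u; rewrite in_itv/= => /andP[].
Qed.

Lemma norm_le_pow_of_derive h (dh : R -> R) (C u : R) (n : nat) :
  (forall t : R, is_derive t 1 h (dh t)) -> h 0 = 0 ->
  (forall t, `|dh t| <= C * `|t| ^+ n) ->
  `|h u| <= C / n.+1%:R * `|u| ^+ n.+1.
Proof.
wlog u0 : h dh u / 0 <= u.
  move=> H hd h0 hC; have [u0|u0] := leP 0 u; first exact: H hd h0 hC.
  rewrite -(normrN u) -{1}(opprK u).
  apply: (H (h \o -%R) (fun t => dh (- t) * -1)); rewrite ?oppr_ge0 ?ltW//= ?oppr0//.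
  by move=> t; rewrite mulrN1 normrN -(normrN t); exact: hC.
move=> hd h0 hC; rewrite (ger0_norm u0) ler_norml; apply/andP; split.
  rewrite lerNl; apply: (@le_pow_of_derive (- h) (- dh)) => //.
    by rewrite /= fctE h0 oppr0.
  move=> t t0; rewrite fctE (le_trans (ler_norm _))// normrN (le_trans (hC t))//.
  by rewrite ger0_norm.
apply: (@le_pow_of_derive h dh) => // t t0.
by rewrite (le_trans (ler_norm _))// (le_trans (hC t))// ger0_norm.
Qed.

Definition taylor_poly (p : nat) f (a u : R) : R :=
  \sum_(i < p) derive1n i f a / i`!%:R * u ^+ i.

(** Induction on [p]: the remainder of order [p.+1] vanishes at [u = 0], and its derivative is the
    remainder of order [p] for the derivative of [f]. *)
Lemma taylor_bound (p : nat) f (F a u : R) :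
  (forall i, (i < p)%N -> forall x, derivable (derive1n i f) x 1) ->
  (forall x, `|derive1n p f x| <= F) ->
  `|f (a + u) - taylor_poly p f a u| <= F / p`!%:R * `|u| ^+ p.
Proof.
elim: p f u => [|p IH] f u df fF.
  by rewrite /taylor_poly big_ord0 subr0 fact0 divr1 expr0 mulr1; exact: fF.
rewrite factS natrM [p.+1%:R * _]mulrC invfM mulrA.
pose T : {poly R} := \poly_(i < p.+1) (derive1n i f a / i`!%:R).
have TE t : T.[t] = taylor_poly p.+1 f a t.
  by rewrite /T horner_poly.
have T'E t : T^`().[t] = taylor_poly p (derive1 f) a t.
  have -> : T^`() = \poly_(i < p) (derive1n i (derive1 f) a / i`!%:R).
    apply/polyP => i; rewrite coef_deriv !coef_poly ltnS.
    case: ltnP => ip; last by rewrite mul0rn.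
    rewrite derive1Sn factS natrM -mulr_natr invfM.
    by field; rewrite pnatr_eq0 -?lt0n ?fact_gt0//= -natr1 natr1 pnatr_eq0.
  by rewrite horner_poly.
have hd (t : R) : is_derive t 1 (fun t => f (a + t) - T.[t]) (derive1 f (a + t) - T^`().[t]).
  apply: is_deriveB; rewrite -[derive1 f _]mulr1.
  have dfat : is_derive (a + t) 1 f (derive1 f (a + t)).
    by rewrite derive1E; apply/derivableP; exact: (df 0%N).
  have dg : is_derive t (1 : R) (fun t => a + t) 1.
    by rewrite -[X in is_derive _ _ _ X]add0r; exact: is_deriveD.
  exact: (@is_derive1_comp _ f (fun t => a + t) t _ _ dfat dg).
have := @norm_le_pow_of_derive _ _ (F / p`!%:R) u p hd; rewrite -TE; apply.
  rewrite addr0 TE /taylor_poly big_ord_recl big1 ?expr0 ?mulr1 ?divr1 ?addr0 ?subrr//.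
  by move=> i _; rewrite expr0n mulr0.
move=> t; rewrite T'E; apply: IH => [i ip x|x]; rewrite -derive1Sn//.
exact: df.
Qed.
End taylor.

(** Only [F] shows in the final estimate. The bounds on lower derivatives serve integrability and
    the Lipschitz property, so they stay existential. *)
Definition bounded_smooth (R : realType) (p : nat) (F : R) (f : R -> R) : Prop :=
  [/\ forall i, (i < p)%N -> forall x, derivable (derive1n i f) x 1,
      forall i, (i < p)%N -> exists C, forall x, `|derive1n i f x| <= C &
      forall x, `|derive1n p f x| <= F].

Lemma continuous_smooth (R : realType) (p : nat) (F : R) (f : R -> R) i :
  bounded_smooth p F f -> (i < p)%N -> continuous (derive1n i f).
Proof.
move=> [df _ _] ip x; apply/differentiable_continuous/derivable1_diffP.
exact: df.
Qed.

Section swap.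
Context d (T : measurableType d) (R : realType) (P : probability T R).
Context (X : nat -> {RV P >-> R}) (k : nat) (p : nat) (F : R) (f : R -> R) (A B : T -> R).
Hypothesis p0 : (0 < p)%N.
Hypothesis indepX : mutually_independent X.
Hypothesis fF : bounded_smooth p F f.
Hypothesis mA : measurable_fun [set: others X k] (A : others X k -> R).
Hypothesis mB : measurable_fun [set: others X k] (B : others X k -> R).
Hypothesis iB : rintegrable P (fun w => `|B w| ^+ p).
Hypothesis iX : rintegrable P (fun w => `|X k w| ^+ p).
Local Notation "'E U" := (\int[P]_w U w) (at level 10, U at level 8).

Lemma rintegrable_expr (U : T -> R) i : measurable_fun setT U -> (i <= p)%N ->
  rintegrable P (fun w => `|U w| ^+ p) -> rintegrable P (fun w => U w ^+ i).
Proof.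
move=> mU ip iU; apply: (@rintegrable_le _ _ _ _ _ (fun w => `|U w| ^+ p + 1)).
- exact: measurable_funX.
- by apply: rintegrableD => //; exact: rintegrable_cst.
move=> w; have := @expr_mixed_le _ `|U w| 1 i (p - i) (normr_ge0 _) ler01.
by rewrite !expr1n mulr1 normrX subnKC.
Qed.

Let mB' := measurable_fun_of_others indepX mB.

Let coef i w := derive1n i f (A w) / i`!%:R * B w ^+ i.

Let mcoef i : (i < p)%N -> measurable_fun [set: others X k] (coef i : others X k -> R).
Proof.
move=> ip; apply: measurable_funM; last exact: measurable_funX.
apply: measurable_funM => //; apply: measurableT_comp mA.
by apply: continuous_measurable_fun => x; exact: (continuous_smooth fF ip).
Qed.

Let icoef i : (i < p)%N -> rintegrable P (coef i).
Proof.
move=> ip; have [_ /(_ i ip)[C fC] _] := fF.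
apply: (@rintegrable_le _ _ _ _ _ (fun w => C * `|B w ^+ i|)).
- exact: (measurable_fun_of_others indepX (mcoef ip)).
- apply: rintegrableZ.
  have := rintegrable_expr mB' (ltnW ip) iB.
  by move=> H; apply: integrable_norm H.
move=> w; rewrite normrM ler_wpM2r// normrM normfV ler_pdivrMr; last first.
  by rewrite normr_gt0 pnatr_eq0 -lt0n fact_gt0.
rewrite (le_trans (fC _))// ler_peMr//; last by rewrite normr_nat ler1n fact_gt0.
exact: le_trans (fC 0).
Qed.

(** Taylor expansion at [A], each term factoring by independence. The subtracted sum depends on
    [X k] only through its moments of order less than [p], hence is common to two sequences that
    share them. *)
Lemma swap_one_side :
  `|'E (fun w => f (A w + X k w * B w)) -
    \sum_(i < p) 'E (fun w => derive1n i f (A w) / i`!%:R * B w ^+ i) * 'E (fun w => X k w ^+ i)| <=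
  F / p`!%:R * ('E (fun w => `|B w| ^+ p) * 'E (fun w => `|X k w| ^+ p)).
Proof.
have mX i : measurable_fun setT (fun x : R => x ^+ i) by exact: measurable_funX.
have mXn : measurable_fun setT (fun x : R => `|x| ^+ p) by exact: measurable_funX.
have iXi i : (i < p)%N -> rintegrable P (fun w => X k w ^+ i).
  by move=> ip; apply: rintegrable_expr iX => //; exact: ltnW.
have ic (i : 'I_p) := integrable_othersM indepX (mcoef (ltn_ord i)) (mX i)
   (icoef (ltn_ord i)) (iXi _ (ltn_ord i)).
have ec (i : 'I_p) := Rintegral_othersM indepX (mcoef (ltn_ord i)) (mX i)
   (icoef (ltn_ord i)) (iXi _ (ltn_ord i)).
have mBp : measurable_fun [set: others X k] (fun w : others X k => `|B w| ^+ p).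
  by apply: measurable_funX; exact: measurableT_comp.
have ir := integrable_othersM indepX mBp mXn iB iX.
have er := Rintegral_othersM indepX mBp mXn iB iX.
have mf : measurable_fun setT (fun w => f (A w + X k w * B w)).
  apply: measurableT_comp.
    by apply: continuous_measurable_fun => x; exact: (continuous_smooth (i := 0) fF p0).
  apply: measurable_funD; first exact: (measurable_fun_of_others indepX mA).
  exact: measurable_funM.
have jf : rintegrable P (fun w => f (A w + X k w * B w)).
  have [_ /(_ 0%N p0)[C fC] _] := fF.
  by apply: (@rintegrable_le _ _ _ _ _ (fun=> C)) => //; exact: rintegrable_cst.
rewrite -(eq_bigr _ (fun i _ => ec i)) -ER_sum// -RintegralB//; last exact: rintegrable_sum.
apply: le_trans (ER_norm _) _; first by apply: rintegrableB => //; exact: rintegrable_sum.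
rewrite -er -ERZ//; apply: ER_le; last 1 first.
- move=> w; have [df _ fp] := fF.
  have := @taylor_bound _ p f F (A w) (X k w * B w) df fp.
  rewrite /taylor_poly normrM exprMn [X in _ <= _ * X]mulrC => H.
  apply: le_trans H; rewrite le_eqVlt; apply/orP; left; apply/eqP; congr (`|_ - _|).
  by apply: eq_bigr => i _; rewrite exprMn /coef mulrCA mulrC.
- by apply: integrable_norm; apply: rintegrableB => //; exact: rintegrable_sum.
- exact: rintegrableZ.
Qed.
End swap.

(** Both expectations are compared with the same Taylor sum, hence the factor [2]. Measurability is
    asked twice because [others X k] and [others X' k] are different sigma-algebras on one set. *)
Lemma swap_le d (T : measurableType d) (R : realType) (P : probability T R)
    (X X' : nat -> {RV P >-> R}) (k p : nat) (F mu : R) (f : R -> R) (A B : T -> R) :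
  (0 < p)%N -> mutually_independent X -> mutually_independent X' ->
  bounded_smooth p F f ->
  measurable_fun [set: others X k] (A : others X k -> R) ->
  measurable_fun [set: others X k] (B : others X k -> R) ->
  measurable_fun [set: others X' k] (A : others X' k -> R) ->
  measurable_fun [set: others X' k] (B : others X' k -> R) ->
  rintegrable P (fun w => `|B w| ^+ p) ->
  rintegrable P (fun w => `|X k w| ^+ p) ->
  rintegrable P (fun w => `|X' k w| ^+ p) ->
  (forall i, (i < p)%N -> \int[P]_w (X k w ^+ i) = \int[P]_w (X' k w ^+ i)) ->
  \int[P]_w (`|X k w| ^+ p) <= mu -> \int[P]_w (`|X' k w| ^+ p) <= mu ->
  `|\int[P]_w (f (A w + X k w * B w)) - \int[P]_w (f (A w + X' k w * B w))| <=
  2 * F / p`!%:R * mu * \int[P]_w (`|B w| ^+ p).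
Proof.
move=> p0 iX iX' fF mA mB mA' mB' jB jX jX' EE mu1 mu2.
have := swap_one_side p0 iX fF mA mB jB jX.
have := swap_one_side p0 iX' fF mA' mB' jB jX'.
rewrite (eq_bigr (fun i : 'I_p => \int[P]_w (derive1n i f (A w) / i`!%:R * B w ^+ i) *
   \int[P]_w (X k w ^+ i))); last by move=> i _; rewrite EE.
set a := \int[P]_w f _; set a' := \int[P]_w f _; set s := \sum_(_ < _) _.
set b := \int[P]_w (`|B w| ^+ p).
set x := \int[P]_w (`|X k w| ^+ p); set x' := \int[P]_w (`|X' k w| ^+ p) => H' H.
have F0 : 0 <= F / p`!%:R.
  rewrite divr_ge0//; have [_ _ fp] := fF; exact: le_trans (fp 0).
have b0 : 0 <= b by apply: Rintegral_ge0 => w _; exact: exprn_ge0.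
apply: (@le_trans _ _ (F / p`!%:R * (b * x) + F / p`!%:R * (b * x'))).
  have -> : a' - a = (a' - s) - (a - s) by ring.
  by apply: le_trans (ler_normB _ _) _; exact: lerD.
have -> : 2 * F / p`!%:R * mu * b = F / p`!%:R * (b * mu) + F / p`!%:R * (b * mu) by ring.
by apply: lerD; rewrite !ler_wpM2l.
Qed.

Section hybrid_moments.
Context d d' (T : measurableType d) (T' : measurableType d') (R : realType).
Variables (P : probability T R) (P' : probability T' R).
Variables (Z : nat -> {RV P >-> R}) (Z' : nat -> {RV P' >-> R}).
Local Notation PP := (P \x P')%E.

Lemma hybrid_moment (i k : nat) (g : R -> R) :
  rintegrable P (fun w => g (Z k w)) -> rintegrable P' (fun w => g (Z' k w)) ->
  rintegrable PP (fun w => g (hybrid Z Z' i k w)) /\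
  \int[PP]_w g (hybrid Z Z' i k w) =
    if (k < i)%N then \int[P']_w g (Z' k w) else \int[P]_w g (Z k w).
Proof.
rewrite /hybrid /= /hybrid_fun => iZ iZ'; case: ifP => _.
  split; first exact: (integrable_measure_preserving measurable_snd (@product_snd _ _ _ _ _ P P') iZ').
  exact: (Rintegral_measure_preserving measurable_snd (@product_snd _ _ _ _ _ P P') iZ').
split; first exact: (integrable_measure_preserving measurable_fst (@product_fst _ _ _ _ _ P P') iZ).
exact: (Rintegral_measure_preserving measurable_fst (@product_fst _ _ _ _ _ P P') iZ).
Qed.

End hybrid_moments.

Section telescope.
Context d d' (T : measurableType d) (T' : measurableType d') (R : realType).
Variables (P : probability T R) (P' : probability T' R).
Variables (Z : nat -> {RV P >-> R}) (Z' : nat -> {RV P' >-> R}).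
Variables (n p : nat) (F mu K : R) (f : R -> R) (q : {set 'I_n} -> R).
Hypothesis p0 : (0 < p)%N.
Hypotheses (indepZ : mutually_independent Z) (indepZ' : mutually_independent Z').
Hypothesis fF : bounded_smooth p F f.
Hypothesis iZ : forall k, rintegrable P (fun w => `|Z k w| ^+ p).
Hypothesis iZ' : forall k, rintegrable P' (fun w => `|Z' k w| ^+ p).
Hypothesis ZZ' : forall k i, (i < p)%N ->
  \int[P]_w (Z k w ^+ i) = \int[P']_w (Z' k w ^+ i).
Hypothesis muZ : forall k, \int[P]_w (`|Z k w| ^+ p) <= mu.
Hypothesis muZ' : forall k, \int[P']_w (`|Z' k w| ^+ p) <= mu.
Hypothesis K0 : 0 < K.
Local Notation PP := (P \x P')%E.
Hypothesis step : forall i, contractive_step (hybrid Z Z' i) p K.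

Let swap_hybrid (k : 'I_n) :
  `|\int[PP]_w f (mlpoly q (fun j => hybrid Z Z' k j w)) -
    \int[PP]_w f (mlpoly q (fun j => hybrid Z Z' k.+1 j w))| <=
  2 * F / p`!%:R * mu * Num.sqrt (wnorm K (diff_part k q)) ^+ p.
Proof.
(* The two hybrids differ at index [k] only, which neither [A] nor [B] sees. *)
have eq_hyb w j : j != k :> nat -> hybrid Z Z' k.+1 j w = hybrid Z Z' k j w.
  by move=> jk; rewrite /hybrid/= /hybrid_fun ltnS leq_eqVlt (negPf jk).
pose A w := mlpoly (const_part k q) (fun j => hybrid Z Z' k j w).
pose B w := mlpoly (diff_part k q) (fun j => hybrid Z Z' k j w).
have AE w : mlpoly (const_part k q) (fun j => hybrid Z Z' k.+1 j w) = A w.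
  by apply: (eq_mlpoly (@const_part0 _ _ k q)) => j; exact: eq_hyb.
have BE w : mlpoly (diff_part k q) (fun j => hybrid Z Z' k.+1 j w) = B w.
  by apply: (eq_mlpoly (@diff_part0 _ _ k q)) => j; exact: eq_hyb.
have hm i := @hybrid_moment _ _ _ _ _ P P' Z Z' i k (fun x => `|x| ^+ p) (iZ k) (iZ' k).
have hmu i : \int[PP]_w (`|hybrid Z Z' i k w| ^+ p) <= mu.
  by rewrite (hm i).2; case: ifP.
have hE i j : (j < p)%N ->
    \int[PP]_w (hybrid Z Z' i k w ^+ j) = \int[P]_w (Z k w ^+ j).
  move=> jp.
  have e1 := rintegrable_expr (measurable_funPT (Z k)) (ltnW jp) (iZ k).
  have e2 := rintegrable_expr (measurable_funPT (Z' k)) (ltnW jp) (iZ' k).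
  rewrite (@hybrid_moment _ _ _ _ _ P P' Z Z' i k (fun x => x ^+ j) e1 e2).2.
  by case: ifP => // _; rewrite ZZ'.
have [iB EB] := hypercontractivity K0 p0 (@step k) (diff_part k q).
have H := @swap_le _ _ _ PP (hybrid Z Z' k) (hybrid Z Z' k.+1) k p F mu f A B p0
  (hybrid_independent indepZ indepZ' k) (hybrid_independent indepZ indepZ' k.+1) fF.
have F0 : 0 <= 2 * F / p`!%:R * mu.
  rewrite !mulr_ge0// ?invr_ge0//.
    by have [_ _ fp] := fF; exact: le_trans (fp 0).
  by apply: le_trans (muZ 0); apply: Rintegral_ge0 => w _; exact: exprn_ge0.
apply: le_trans (ler_wpM2l F0 EB).
have -> : \int[PP]_w f (mlpoly q (fun j => hybrid Z Z' k j w)) =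
  \int[PP]_w f (A w + hybrid Z Z' k k w * B w).
  by apply: eq_Rintegral => w _; rewrite (mlpoly_split k).
have -> : \int[PP]_w f (mlpoly q (fun j => hybrid Z Z' k.+1 j w)) =
  \int[PP]_w f (A w + hybrid Z Z' k.+1 k w * B w).
  by apply: eq_Rintegral => w _; rewrite (mlpoly_split k) AE BE.
apply: H => //.
- by apply: measurable_mlpoly_others; exact: const_part0.
- by apply: measurable_mlpoly_others; exact: diff_part0.
- rewrite -(funext AE).
  by apply: measurable_mlpoly_others; exact: const_part0.
- rewrite -(funext BE).
  by apply: measurable_mlpoly_others; exact: diff_part0.
- exact: (hm _).1.
- exact: (hm _).1.
- by move=> j jp; rewrite !hE.
Qed.

Lemma lindeberg :
  `|\int[P]_w f (mlpoly q (Z ^~ w)) - \int[P']_w f (mlpoly q (Z' ^~ w))| <=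
  2 * F / p`!%:R * mu * \sum_(k < n) Num.sqrt (wnorm K (diff_part k q)) ^+ p.
Proof.
pose a (i : nat) := \int[PP]_w f (mlpoly q (fun j => hybrid Z Z' i j w)).
have [_ /(_ 0%N p0)[C fC] _] := fF.
have mf : measurable_fun setT f.
  by apply: continuous_measurable_fun => x; exact: (continuous_smooth (i := 0) fF p0).
have bounded_int d0 (T0 : measurableType d0) (P0 : probability T0 R) (Y : nat -> {RV P0 >-> R}) :
    rintegrable P0 (fun w => f (mlpoly q (Y ^~ w))).
  apply: (@rintegrable_le _ _ _ _ _ (fun=> C)) => //; last exact: rintegrable_cst.
  by apply: measurableT_comp mf _; exact: measurable_mlpoly.
(* Endpoints of the telescope: hybrid [0] uses only [Z], hybrid [n] only [Z'] on the [n] variables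
   present, and the projections preserve the measures. *)
have -> : \int[P]_w f (mlpoly q (Z ^~ w)) = a 0%N.
  rewrite /a -(Rintegral_measure_preserving measurable_fst (@product_fst _ _ _ _ _ P P') (bounded_int _ _ P Z)).
  by apply: eq_Rintegral => w _; congr f; apply: eq_bigr.
have -> : \int[P']_w f (mlpoly q (Z' ^~ w)) = a n.
  rewrite /a -(Rintegral_measure_preserving measurable_snd (@product_snd _ _ _ _ _ P P') (bounded_int _ _ P' Z')).
  apply: eq_Rintegral => w _; congr f; apply: eq_bigr => A _; congr (_ * _); apply: eq_bigr => i _.
  by rewrite /hybrid /= /hybrid_fun ltn_ord.
rewrite -(opprB (a n)) normrN -telescope_sumr// big_mkord mulr_sumr.
apply: le_trans (ler_norm_sum _ _ _) _; apply: ler_sum => k _.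
by rewrite distrC; exact: swap_hybrid.
Qed.

End telescope.

(** * Symmetric coefficients *)

Section symmetric_sums.
Context (R : realType) (n : nat).

(** Only tuples without repetition count; each set of size [m] is the support of [m!] of them, and
    [g] is constant on these. *)
Lemma sum_tuple_set (m : nat) (g : seq 'I_n -> R) :
  (forall s s', perm_eq s s' -> g s = g s') -> (forall s, ~~ uniq s -> g s = 0) ->
  \sum_(t : m.-tuple 'I_n) g t =
  \sum_(A : {set 'I_n} | #|A| == m) m`!%:R * g (enum A).
Proof.
move=> g_sym g_diag.
rewrite (bigID (fun t : m.-tuple 'I_n => uniq t))/= [X in _ + X]big1 ?addr0; last first.
  by move=> t; exact: g_diag.
rewrite (partition_big (fun t : m.-tuple 'I_n => [set x in (t : seq 'I_n)])
  (fun A : {set 'I_n} => #|A| == m))/=; last first.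
  by move=> t ut; rewrite cardsE (card_uniqP ut) size_tuple.
apply: eq_bigr => A /eqP Am.
have condE (t : m.-tuple 'I_n) : uniq t && ([set x in (t : seq 'I_n)] == A) =
   (t \in [set t : m.-tuple 'I_n | all (mem A) t & uniq t]).
  rewrite inE andbC; apply/andP/andP => [[/eqP <- ut]|[tA ut]]; split => //.
    by apply/allP => x xt; suff : x \in [set y in (t : seq 'I_n)] by []; rewrite inE.
  rewrite eqEcard cardsE (card_uniqP ut) size_tuple Am leqnn andbT.
  by apply/fintype.subsetP => x; rewrite inE => /(allP tA).
rewrite (eq_bigl _ _ condE) (eq_bigr (fun=> g (enum A))); last first.
  move=> t; rewrite inE => /andP[tA ut]; apply: g_sym; apply: uniq_perm => //.
    exact: enum_uniq.
  have : [set x in (t : seq 'I_n)] = A.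
    by apply/eqP; have := condE t; rewrite inE tA ut /= => ->.
  by move=> tE x; rewrite mem_enum -tE inE.
by rewrite sumr_const card_uniq_tuples Am ffactnn mulr_natl.
Qed.

Lemma sum_card_lt (N : nat) (F : {set 'I_n} -> R) :
  \sum_(m < N) \sum_(A : {set 'I_n} | #|A| == m) F A =
  \sum_(A : {set 'I_n}) (if (#|A| < N)%N then F A else 0).
Proof.
rewrite (exchange_big_dep xpredT)//=; apply: eq_bigr => A _.
case: ltnP => AN.
  rewrite (big_pred1 (Ordinal AN))// => i; rewrite eq_sym -val_eqE //.
by rewrite big1 // => i /eqP iA; have := ltn_ord i; rewrite -iA ltnNge AN.
Qed.

End symmetric_sums.

Section chaos_polynomial.
Context (R : realType) (n N : nat) (c : seq nat -> R).
Hypotheses (c_sym : symmetric_coeff c) (c_diag : null_on_diagonals c).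

(* The factorial counts the orderings of [A], each giving the same term. *)
Definition chaos_coeff (A : {set 'I_n}) : R :=
  if (#|A| < N)%N then (#|A|)`!%:R * c (map val (enum A)) else 0.

Definition slice_norm (k m : nat) : R :=
  \sum_(t : m.-tuple 'I_n) c (k :: map val t) ^+ 2.

Lemma mlpoly_chaos (z : nat -> R) :
  mlpoly chaos_coeff z =
  \sum_(m < N) \sum_(t : m.-tuple 'I_n) c (map val t) * \prod_(i <- map val t) z i.
Proof.
have E (m : 'I_N) : \sum_(t : m.-tuple 'I_n) c (map val t) * \prod_(i <- map val t) z i =
    \sum_(A : {set 'I_n} | #|A| == m) (#|A|)`!%:R *
      (c (map val (enum A)) * \prod_(i in A) z i).
  rewrite (@sum_tuple_set _ _ m (fun s => c (map val s) * \prod_(i <- map val s) z i)).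
  - apply: eq_bigr => A /eqP ->; congr (_ * (_ * _)).
    by rewrite big_map big_enum.
  - move=> s s' ss'; have mss' : perm_eq (map val s) (map val s') by exact: perm_map.
    by rewrite (c_sym mss') (perm_big _ mss').
  - by move=> s us; rewrite c_diag ?mul0r// map_inj_uniq//; exact: val_inj.
rewrite (eq_bigr _ (fun m _ => E m)) sum_card_lt; apply: eq_bigr => A _.
by rewrite /chaos_coeff; case: ifP => _; rewrite ?mul0r// mulrA.
Qed.

(** On a set of size [m] the derivative has coefficient [(m + 1)! * c (k, A)]. Of its square, one
    [m!] is spent on returning from sets to tuples and [(m + 1) ^+ 2 * m!] remains. Degree [m] comes
    from degree [m + 1] of the truncation, hence the test [m.+1 < N]. *)
Lemma wnorm_chaos K (k : 'I_n) :
  wnorm K (diff_part k chaos_coeff) =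
  \sum_(m < N) (if (m.+1 < N)%N then K ^+ m * (m.+1%:R ^+ 2 * m`!%:R) * slice_norm k m else 0).
Proof.
have E (m : 'I_N) : slice_norm k m =
    \sum_(A : {set 'I_n} | #|A| == m) m`!%:R * c (val k :: map val (enum A)) ^+ 2.
  rewrite /slice_norm (@sum_tuple_set _ _ m (fun s => c (val k :: map val s) ^+ 2))//.
  - move=> s s' ss'; congr (_ ^+ 2); apply: c_sym.
    by rewrite perm_cons; exact: perm_map.
  - move=> s us; rewrite c_diag ?expr0n//= negb_and map_inj_uniq ?us ?orbT//; exact: val_inj.
pose F (A : {set 'I_n}) := if ((#|A|).+1 < N)%N then
  K ^+ #|A| * ((#|A|).+1)`!%:R ^+ 2 * c (val k :: map val (enum A)) ^+ 2 else 0.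
transitivity (\sum_(m < N) \sum_(A : {set 'I_n} | #|A| == m) F A); last first.
  apply: eq_bigr => m _; rewrite E; case: ifP => mN.
    rewrite big_distrr/=; apply: eq_bigr => A /eqP Am.
    by rewrite /F Am mN factS natrM; ring.
  by apply: big1 => A /eqP Am; rewrite /F Am mN.
rewrite sum_card_lt; apply: eq_bigr => A _.
rewrite /diff_part /chaos_coeff /F.
have [kA|kA] := boolP (k \in A).
  rewrite expr0n mulr0 c_diag ?expr0n ?mulr0; first by case: ifP => //; case: ifP.
  by rewrite /= mem_map ?mem_enum ?kA//; exact: val_inj.
rewrite cardsU1 kA add1n.
have [kN|] := ltnP (#|A|).+1 N; last first.
  by rewrite expr0n mulr0 if_same.
rewrite (ltnW kN) exprMn mulrA; congr (_ * _ ^+ 2); apply: c_sym.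
rewrite -map_cons; apply: perm_map; apply: uniq_perm; rewrite /= ?enum_uniq ?andbT ?mem_enum//.
by move=> x; rewrite mem_enum !inE mem_enum.
Qed.

Section bounds.
Variables (K M : R).
Hypotheses (K0 : 0 <= K) (KM : K <= 3 / 4 * M) (M3 : 3 <= M).

Lemma pow_ratio1 m : m.+1%:R * K ^+ m <= 2 * M ^+ m.
Proof.
have M0 : 0 <= M by have := M3; lra.
have H : m.+1%:R * (3 / 4) ^+ m <= 2 :> R.
  (* The maximum, [27 / 16], is attained at [m = 2] and [m = 3]; the sequence does not increase from
     [m = 2] on, where the induction starts. *)
  case: m => [|[|m]]; [by rewrite expr0 mulr1; lra|by rewrite expr1; lra|].
  elim: m => [|m]; first by rewrite expr2; lra.
  rewrite (exprS _ m.+2); apply: le_trans.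
  rewrite mulrA ler_wpM2r ?exprn_ge0 ?divr_ge0//.
  have -> : m.+4%:R = m%:R + 4 :> R by rewrite -addn4 natrD.
  have -> : m.+3%:R = m%:R + 3 :> R by rewrite -addn3 natrD.
  by have : 0 <= m%:R :> R by []; lra.
apply: (@le_trans _ _ (m.+1%:R * (3 / 4 * M) ^+ m)).
  by rewrite ler_wpM2l// lerXn2r ?nnegrE ?mulr_ge0 ?divr_ge0.
by rewrite exprMn mulrA ler_wpM2r ?exprn_ge0.
Qed.

(** From [m + 1 <= 2 ^ m], and [4 * (3 / 4 * M) = 3 * M <= M ^+ 2]: this is where [3 <= M] is
    spent. *)
Lemma pow_ratio2 m : m.+1%:R ^+ 2 * K ^+ m <= M ^+ (2 * m).
Proof.
have M0 : 0 <= M by have := M3; lra.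
have H : m.+1%:R ^+ 2 <= 4 ^+ m :> R.
  have -> : 4 = 2 ^+ 2 :> R by ring.
  rewrite exprAC lerXn2r ?nnegrE ?exprn_ge0//.
  by rewrite -natrX ler_nat; exact: ltn_expl.
apply: (@le_trans _ _ (4 ^+ m * (3 / 4 * M) ^+ m)).
  by apply: ler_pM; rewrite ?sqr_ge0 ?exprn_ge0// lerXn2r ?nnegrE ?mulr_ge0 ?divr_ge0.
rewrite -exprMn exprM lerXn2r ?nnegrE ?sqr_ge0//; first by rewrite !mulr_ge0 ?divr_ge0.
have -> : 4 * (3 / 4 * M) = 3 * M by field.
by rewrite expr2 ler_wpM2r.
Qed.

Lemma slice_norm_ge0 k m : 0 <= slice_norm k m.
Proof. by apply: sumr_ge0 => t _; rewrite sqr_ge0. Qed.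

Definition influence (k : nat) : R :=
  \sum_(m < N) M ^+ (2 * m) * m`!%:R * slice_norm k m.

(** A finite part of the squared [N0], the first index [k] being split off from each multi-index of
    length [m.+1]. *)
Definition total_norm : R :=
  \sum_(m < N) M ^+ m.+1 * (m.+1)`!%:R * \sum_(k < n) slice_norm k m.

Lemma wnorm_influence (k : 'I_n) : wnorm K (diff_part k chaos_coeff) <= influence k.
Proof.
have M0 : 0 <= M by have := M3; lra.
rewrite wnorm_chaos; apply: ler_sum => m _; case: ifP => _; last first.
  by rewrite !mulr_ge0 ?exprn_ge0 ?slice_norm_ge0.
rewrite ler_wpM2r ?slice_norm_ge0// mulrA ler_wpM2r// mulrC.
exact: pow_ratio2.
Qed.

Lemma sum_wnorm_le :
  \sum_(k < n) wnorm K (diff_part k chaos_coeff) <= 2 / M * total_norm.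
Proof.
have M0 : 0 < M by have := M3; lra.
rewrite (eq_bigr _ (fun k _ => wnorm_chaos K k)) exchange_big/= mulr_sumr.
apply: ler_sum => m _.
rewrite !mulr_sumr; apply: ler_sum => k _.
rewrite [leRHS]mulrA; case: ifP => _; last first.
  by rewrite !mulr_ge0 ?exprn_ge0 ?slice_norm_ge0 ?invr_ge0 ?ltW.
rewrite ler_wpM2r ?slice_norm_ge0//.
rewrite factS natrM [M ^+ m.+1]exprS.
have -> : 2 / M * (M * M ^+ m * (m.+1%:R * m`!%:R)) = (2 * M ^+ m) * (m.+1%:R * m`!%:R).
  by field; rewrite gt_eqF.
have -> : K ^+ m * (m.+1%:R ^+ 2 * m`!%:R) = (m.+1%:R * K ^+ m) * (m.+1%:R * m`!%:R) by ring.
by rewrite ler_wpM2r ?mulr_ge0//; exact: pow_ratio1.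
Qed.

(** With [W] the weighted norm, [sqrt W ^ p = W * sqrt W ^ (p - 2)]: the factor [W] is summed over
    [k] and yields [total_norm], the other one is bounded by the largest influence. *)
Lemma sum_sqrt_wnorm_le (p : nat) (e : R) : (2 <= p)%N -> 0 <= e ->
  (forall k : 'I_n, influence k <= e ^+ 2) ->
  \sum_(k < n) Num.sqrt (wnorm K (diff_part k chaos_coeff)) ^+ p <=
  2 / M * total_norm * e ^+ (p - 2).
Proof.
move=> p2 e0 He.
apply: le_trans (ler_wpM2r (exprn_ge0 (p - 2) e0) sum_wnorm_le).
rewrite mulr_suml; apply: ler_sum => k _.
have W0 : 0 <= wnorm K (diff_part k chaos_coeff).
  by apply: sumr_ge0 => A _; rewrite mulr_ge0 ?sqr_ge0 ?exprn_ge0.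
rewrite -{1}(subnKC p2) exprD sqr_sqrtr// ler_wpM2l// lerXn2r ?nnegrE ?sqrtr_ge0//.
rewrite -(ler_pXn2r (n := 2)) ?nnegrE ?sqrtr_ge0// sqr_sqrtr//.
exact: le_trans (wnorm_influence k) (He k).
Qed.

End bounds.
End chaos_polynomial.

Lemma sum_inj_le_esum (R : realType) (I : finType) (J : choiceType)
    (h : I -> J) (a : J -> R) : injective h -> (forall j, 0 <= a j) ->
  ((\sum_i a (h i))%:E <= \esum_(j in [set: J]) (a j)%:E)%E.
Proof.
move=> hinj a0; apply: esum_ge; exists [set` map h (enum I)].
  by split=> //; exact: finite_seq.
rewrite -fsbig_seq/=; last by rewrite map_inj_uniq// enum_uniq.
by rewrite big_map big_enum sumEFin.
Qed.

Section ereal_bounds.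
Context (R : realType) (n N : nat) (c : seq nat -> R) (M : R).
Hypothesis M0 : 0 <= M.

Lemma slice_norm_le_esum k m :
  ((slice_norm n c k m)%:E <= \esum_(a in [set: m.-tuple nat]) ((c (k :: a)) ^+ 2)%:E)%E.
Proof.
have hinj : injective (fun t : m.-tuple 'I_n => map_tuple (val : 'I_n -> nat) t).
  by move=> t t' /(congr1 val)/= /inj_map tt'; apply/val_inj/tt'; exact: val_inj.
exact: (sum_inj_le_esum (a := fun a : m.-tuple nat => c (k :: a) ^+ 2) hinj (fun=> sqr_ge0 _)).
Qed.

Lemma sum_slice_norm_le m :
  ((\sum_(k < n) slice_norm n c k m)%:E <= coeff_norm c m.+1 ^+ 2)%E.
Proof.
rewrite /coeff_norm sqr_sqrte; last by apply: esum_ge0 => a _; rewrite lee_fin sqr_ge0.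
rewrite pair_big/=.
have hinj : injective (fun u : 'I_n * m.-tuple 'I_n =>
    cons_tuple (val u.1) (map_tuple (val : 'I_n -> nat) u.2)).
  move=> [k t] [k' t'] /(congr1 val)/= [] /val_inj -> /inj_map tt'.
  by congr (_, _); apply/val_inj/tt'; exact: val_inj.
exact: (sum_inj_le_esum (a := fun a : m.+1.-tuple nat => c a ^+ 2) hinj (fun=> sqr_ge0 _)).
Qed.

Lemma total_norm_le : ((total_norm n N c M)%:E <= N0 c M ^+ 2)%E.
Proof.
have t0 m : (0 <= (M ^+ m * m`!%:R)%:E * coeff_norm c m ^+ 2)%E.
  by rewrite mule_ge0 ?lee_fin ?mulr_ge0 ?exprn_ge0// expe_ge0// sqrte_ge0.
rewrite /N0 sqr_sqrte; last by apply: nneseries_ge0 => m _ _; exact: t0.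
apply: le_trans (@nneseries_lim_ge _ _ xpredT 0 N.+1 (fun m _ _ => t0 m)).
rewrite big_ltn// big_add1/= big_mkord -[leLHS]add0e leeD//.
rewrite /total_norm -sumEFin; apply: lee_sum => m _.
rewrite EFinM lee_wpmul2l ?lee_fin ?mulr_ge0 ?exprn_ge0//.
exact: sum_slice_norm_le.
Qed.

Lemma influence_le k : ((Num.sqrt (influence n N c M k))%:E <= eps0 c M)%E.
Proof.
have t0 m : (0 <= (M ^+ (2 * m) * m`!%:R)%:E *
    \esum_(a in [set: m.-tuple nat]) ((c (k :: a)) ^+ 2)%:E)%E.
  rewrite mule_ge0 ?lee_fin ?mulr_ge0 ?exprn_ge0//.
  by apply: esum_ge0 => a _; rewrite lee_fin sqr_ge0.
apply: (@le_trans _ _ (sqrte (\sum_(0 <= m <oo) (M ^+ (2 * m) * m`!%:R)%:E *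
    \esum_(a in [set: m.-tuple nat]) ((c (k :: a)) ^+ 2)%:E)%E)); last first.
  by apply: ereal_sup_ubound; exists k.
change ((Num.sqrt (influence n N c M k))%:E) with (sqrte (influence n N c M k)%:E).
rewrite lee_sqrt; last by apply: nneseries_ge0 => m _ _; exact: t0.
apply: le_trans (@nneseries_lim_ge _ _ xpredT 0 N (fun m _ _ => t0 m)).
rewrite big_mkord /influence -sumEFin; apply: lee_sum => m _.
rewrite EFinM lee_wpmul2l ?lee_fin ?mulr_ge0 ?exprn_ge0//.
exact: slice_norm_le_esum.
Qed.

Lemma eps0_ge0 : (0 <= eps0 c M)%E.
Proof. by apply: le_trans (influence_le 0); rewrite lee_fin sqrtr_ge0. Qed.

(** [eps0 c M] may be infinite; a real number below it that dominates the [n] influences present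
    keeps the estimates in [R]. *)
Lemma exists_eps_le : exists e : R, [/\ 0 <= e, (e%:E <= eps0 c M)%E &
  forall k : 'I_n, influence n N c M k <= e ^+ 2].
Proof.
exists (\big[Num.max/0]_(k < n) Num.sqrt (influence n N c M k)); split.
- by elim/big_ind: _ => // x y x0 y0; rewrite le_max x0.
- elim/big_ind: _ => [|x y x0 y0|k _]; first exact: eps0_ge0.
  + by rewrite maxEle; case: ifP.
  + exact: influence_le.
move=> k; have I0 : 0 <= influence n N c M k.
  by apply: sumr_ge0 => m _; rewrite !mulr_ge0 ?exprn_ge0//; apply: sumr_ge0 => t _; rewrite sqr_ge0.
rewrite -(sqr_sqrtr I0) lerXn2r ?nnegrE ?sqrtr_ge0//.
  by elim/big_ind: _ => // x y x0 y0; rewrite le_max x0.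
exact: le_bigmax.
Qed.

End ereal_bounds.

(** * Truncation of the series *)

Section truncation.
Context d (T : measurableType d) (R : realType) (P : probability T R).
Variables (c : seq nat -> R) (Z : nat -> {RV P >-> R}).

Definition chaos_trunc (n m : nat) (w : T) : R :=
  \sum_(t : m.-tuple 'I_n) c (map val t) * monomial Z (map val t) w.

Lemma cvge0_lt (I : Type) (F : set_system I) (u : I -> \bar R) (e : R) :
  Filter F -> u @ F --> 0%E -> 0 < e -> \forall i \near F, (u i < e%:E)%E.
Proof.
move=> FF u0 e0; have := u0 [set y : \bar R | (y < e%:E)%E]; apply; apply: open_nbhs_nbhs; split.
  exact: open_ereal_lt_ereal.
by rewrite /= lte_fin.
Qed.

(** The cubes of multi-indices with entries below [n] are cofinal among finite sets, so the
    unordered sum may be computed along them. *)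
Lemma chaos_trunc_cvg (m : nat) (X : {RV P >-> R}) (e : R) : is_chaos c Z m X -> 0 < e ->
  \forall n \near \oo, (Lnorm P 2%:E (fun w => (X w - chaos_trunc n m w)%:E) < e%:E)%E.
Proof.
move=> cX e0.
have [A _ HA] := @cvge0_lt _ _ _ _ (summability.totally_filter) cX e0.
pose h n (t : m.-tuple 'I_n) := map_tuple (val : 'I_n -> nat) t.
exists (\max_(a <- A) \max_(i <- a) i.+1)%N => // n /= An.
pose s := map (@h n) (enum {: m.-tuple 'I_n}).
have hinj : injective (@h n).
  by move=> t t' /(congr1 val)/= /inj_map tt'; apply/val_inj/tt'; exact: val_inj.
have := HA [fset a in s]%fset; rewrite /= => H.
rewrite (_ : (fun w => _) = (fun w =>
  (X w - \sum_(a <- [fset a in s]%fset) c a * monomial Z a w)%:E)); last first.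
  apply/funext => w; congr (_ - _)%:E.
  rewrite (perm_big s)/=; first by rewrite big_map big_enum.
  apply: uniq_perm; rewrite ?fset_uniq ?map_inj_uniq -?enumT ?enum_uniq//.
  by move=> a; rewrite !inE.
apply: H; apply/fsubsetP => a aA; rewrite inE/=.
have lt_n i : i \in (a : seq nat) -> (i < n)%N.
  move=> ia; apply: leq_trans An.
  apply: leq_trans (@leq_bigmax_seq _ _ xpredT (fun a : m.-tuple nat => \max_(i <- a) i.+1)%N a aA isT).
  exact: (@leq_bigmax_seq _ _ xpredT (fun i => i.+1) i ia isT).
have vE : map val (pmap (insub : nat -> option 'I_n) a) = a.
  rewrite pmap_filter; last exact: insubK.
  by apply/all_filterP/allP => i ia; rewrite /= insubT ?lt_n.
have sz : size (pmap (insub : nat -> option 'I_n) a) == m.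
  by rewrite -(size_map val) vE size_tuple.
apply/mapP; exists (Tuple sz); first by rewrite mem_enum.
by apply/val_inj; rewrite /= vE.
Qed.

Lemma measurable_monomial (a : seq nat) : measurable_fun setT (monomial Z a).
Proof.
rewrite /monomial; elim: a => [|i a IH].
  by under eq_fun do rewrite big_nil; exact: measurable_cst.
by under eq_fun do rewrite big_cons; exact: measurable_funM.
Qed.

Lemma measurable_chaos_trunc n m : measurable_fun setT (chaos_trunc n m).
Proof.
apply: measurable_sum => t; apply: measurable_funM => //.
exact: measurable_monomial.
Qed.

Lemma sum_chaos_trunc_cvg (X : nat -> {RV P >-> R}) (N : nat) (e : R) :
  (forall m, is_chaos c Z m (X m)) -> 0 < e ->
  \forall n \near \oo, (Lnorm P 2%:E (fun w =>
    (\sum_(1 <= m < N) X m w - \sum_(1 <= m < N) chaos_trunc n m w)%:E) < e%:E)%E.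
Proof.
move=> cX; elim: N e => [|N IH] e e0.
  apply: nearW => n; rewrite (_ : (fun _ => _) = cst 0%E) ?Lnorm0 ?lte_fin//.
  by apply/funext => w; rewrite !big_geq// subrr.
have [->|N0] := posnP N.
  apply: nearW => n; rewrite (_ : (fun _ => _) = cst 0%E) ?Lnorm0 ?lte_fin//.
  by apply/funext => w; rewrite !big_geq// subrr.
have e2 : 0 < e / 2 by rewrite divr_gt0.
have H1 := IH _ e2; have H2 := chaos_trunc_cvg (cX N) e2.
near=> n.
have h1 := near H1 n; have h2 := near H2 n.
pose f w := \sum_(1 <= m < N) X m w - \sum_(1 <= m < N) chaos_trunc n m w.
pose g w := X N w - chaos_trunc n N w.
rewrite (_ : (fun _ => _) = EFin \o (f \+ g)); last first.
  by apply/funext => w; rewrite /= !big_nat_recr//= /f /g; congr EFin; ring.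
apply: (@le_lt_trans _ _ ('N[P]_2%:E[EFin \o f] + 'N[P]_2%:E[EFin \o g])%E).
  apply: minkowski_EFin; last by rewrite ler1n.
    by apply: measurable_funB; apply: measurable_sum => m //; exact: measurable_chaos_trunc.
  by apply: measurable_funB => //; exact: measurable_chaos_trunc.
rewrite (_ : e%:E = (e / 2)%:E + (e / 2)%:E)%E; last by rewrite -EFinD -splitr.
by apply: lteD; [exact: h1|exact: h2].
Unshelve. all: by end_near. Qed.

(** The degree is cut at [N] first, and [n] is taken large depending on [N]. The truncation starts
    in degree 0, the series in degree 1; [c [::] = 0] reconciles them. *)
Lemma truncation_cvg (S : {RV P >-> R}) (e : R) : c [::] = 0 -> is_stoch_series c Z S -> 0 < e ->
  \forall N \near \oo, \forall n \near \oo,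
   (Lnorm P 2%:E (fun w => (S w - \sum_(m < N) chaos_trunc n m w)%:E) < e%:E)%E.
Proof.
move=> c0 [X cX SX] e0.
have e2 : 0 < e / 2 by rewrite divr_gt0.
have H := @cvge0_lt _ _ _ _ eventually_filter SX e2.
near=> N.
have N0 : (0 < N)%N by near: N; exact: nbhs_infty_gt.
have H2 := sum_chaos_trunc_cvg N cX e2.
near=> n.
have h1 := near H N; have h2 := near H2 n.
pose f w := S w - \sum_(1 <= m < N) X m w.
pose g w := \sum_(1 <= m < N) X m w - \sum_(1 <= m < N) chaos_trunc n m w.
rewrite (_ : (fun _ => _) = EFin \o (f \+ g)); last first.
  apply/funext => w; rewrite /= /f /g -(big_mkord xpredT (fun m => chaos_trunc n m w)).
  rewrite big_ltn// {1}/chaos_trunc big1 => [|t _]; last by rewrite tuple0 /= c0 mul0r.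
  by congr EFin; ring.
apply: (@le_lt_trans _ _ ('N[P]_2%:E[EFin \o f] + 'N[P]_2%:E[EFin \o g])%E).
  apply: minkowski_EFin; last by rewrite ler1n.
    by apply: measurable_funB => //; exact: measurable_sum.
  by apply: measurable_funB; apply: measurable_sum => m //; exact: measurable_chaos_trunc.
rewrite (_ : e%:E = (e / 2)%:E + (e / 2)%:E)%E; last by rewrite -EFinD -splitr.
by apply: lteD; [exact: h1|exact: h2].
Unshelve. all: by end_near. Qed.

Lemma Lnorm1_le_Lnorm2 (D : T -> R) : measurable_fun setT D ->
  (\int[P]_w `|D w|%:E <= Lnorm P 2%:E (EFin \o D))%E.
Proof.
move=> mD.
have p2 : 0 < 2 :> R by [].
have q2 : 2^-1 + 2^-1 = 1 :> R by field.
have := @hoelder _ _ _ P D (cst 1) 2 2 mD (measurable_cst _) p2 p2 q2.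
rewrite Lnorm1 (_ : EFin \o cst 1 = cst 1%E)// Lnorm_cst1.
rewrite [X in (_ * X `^ _)%E](_ : _ = 1%E); last exact: probability_setT.
rewrite poweR1r mule1; apply: le_trans.
by rewrite le_eqVlt; apply/orP; left; apply/eqP/eq_integral => w _; rewrite /= mulr1.
Qed.

Lemma lipschitz_expectation (f : R -> R) (L e : R) (U V : T -> R) :
  measurable_fun setT f -> (exists C, forall x, `|f x| <= C) ->
  0 <= L -> (forall x y, `|f x - f y| <= L * `|x - y|) ->
  measurable_fun setT U -> measurable_fun setT V ->
  (Lnorm P 2%:E (fun w => (U w - V w)%:E) < e%:E)%E ->
  `|\int[P]_w f (U w) - \int[P]_w f (V w)| <= L * e.
Proof.
move=> mf [C fC] L0 fL mU mV UV.
have mD : measurable_fun setT (fun w => U w - V w) by exact: measurable_funB.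
have lt_e := le_lt_trans (Lnorm1_le_Lnorm2 mD) UV.
have iD : rintegrable P (fun w => U w - V w).
  apply/integrableP; split; first exact/measurable_EFinP.
  by apply: lt_trans lt_e _; rewrite ltry.
have ifW (W : T -> R) : measurable_fun setT W -> rintegrable P (fun w => f (W w)).
  move=> mW; apply: (@rintegrable_le _ _ _ _ _ (fun=> C)) => //; last exact: rintegrable_cst.
  exact: measurableT_comp mf mW.
rewrite -RintegralB//; [|exact: ifW..].
apply: le_trans (ER_norm _) _; first by apply: rintegrableB; exact: ifW.
apply: (@le_trans _ _ (\int[P]_w (L * `|U w - V w|))).
  apply: ER_le => [||w]; last exact: fL.
  - by apply: integrable_norm; apply: rintegrableB; exact: ifW.
  - by apply: rintegrableZ; exact: integrable_norm iD.
rewrite ERZ; last exact: integrable_norm iD.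
rewrite ler_wpM2l// -lee_fin.
apply: le_trans (ltW lt_e); rewrite le_eqVlt; apply/orP; left; apply/eqP.
rewrite /Rintegral fineK//.
by apply: integrable_fin_num => //; exact: integrable_norm iD.
Qed.

End truncation.

Lemma Cb_bounded_smooth (R : realType) (p : nat) (f : R -> R) : Cb p f ->
  exists F : R, [/\ 0 <= F, supnorm (derive1n p f) = F%:E & bounded_smooth p F f].
Proof.
move=> [df _ bf].
have bnd i : (i <= p)%N -> exists C, forall x, `|derive1n i f x| <= C.
  move=> /bf [C [_ /(_ (C + 1))]]; rewrite ltrDl => /(_ ltr01) HC.
  by exists (C + 1) => x; exact: HC.
have [C HC] := bnd p (leqnn p).
have sC : (supnorm (derive1n p f) <= C%:E)%E.
  by apply: ge_ereal_sup => _ [x _ <-]; rewrite lee_fin.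
have s0 x : ((`|derive1n p f x|)%:E <= supnorm (derive1n p f))%E.
  by apply: ereal_sup_ubound; exists x.
have S0 : (0 <= supnorm (derive1n p f))%E.
  by apply: le_trans (s0 0); rewrite lee_fin.
have fin : supnorm (derive1n p f) \is a fin_num.
  by rewrite ge0_fin_numE//; apply: le_lt_trans sC _; rewrite ltry.
exists (fine (supnorm (derive1n p f))); split; [exact: fine_ge0|by rewrite fineK|].
split=> [//||x]; last by rewrite -lee_fin fineK.
by move=> i ip; apply: bnd; exact: ltnW.
Qed.

(** * Passage from truncations to the full series *)

Section invariance.
Context d d' (T : measurableType d) (T' : measurableType d') (R : realType).
Variables (P : probability T R) (P' : probability T' R).
Variables (Z : nat -> {RV P >-> R}) (Z' : nat -> {RV P' >-> R}).
Variables (p : nat) (mu K M : R) (f : R -> R) (c : seq nat -> R).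
Variables (S : {RV P >-> R}) (S' : {RV P' >-> R}).
Hypothesis p2 : (2 <= p)%N.
Hypotheses (indepZ : mutually_independent Z) (indepZ' : mutually_independent Z').
Hypothesis iZ : forall k, rintegrable P (fun w => `|Z k w| ^+ p).
Hypothesis iZ' : forall k, rintegrable P' (fun w => `|Z' k w| ^+ p).
Hypothesis ZZ' : forall k i, (i < p)%N ->
  \int[P]_w (Z k w ^+ i) = \int[P']_w (Z' k w ^+ i).
Hypothesis muZ : forall k, \int[P]_w (`|Z k w| ^+ p) <= mu.
Hypothesis muZ' : forall k, \int[P']_w (`|Z' k w| ^+ p) <= mu.
Hypotheses (K0 : 0 < K) (KM : K <= 3 / 4 * M) (M3 : 3 <= M) (muM : mu <= M).
Hypothesis step : forall i, contractive_step (hybrid Z Z' i) p K.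
Hypotheses (c_sym : symmetric_coeff c) (c_diag : null_on_diagonals c) (c_nil : c [::] = 0).
Hypotheses (hS : is_stoch_series c Z S) (hS' : is_stoch_series c Z' S').

Let truncated (F : R) (n N : nat) : 0 <= F -> bounded_smooth p F f ->
  ((`|\int[P]_w f (\sum_(m < N) chaos_trunc c Z n m w) -
    \int[P']_w f (\sum_(m < N) chaos_trunc c Z' n m w)|)%:E <=
  (2 / p`!%:R)%:E * F%:E * M%:E ^+ p * N0 c M ^+ 2 * eps0 c M ^+ (p - 2))%E.
Proof.
move=> F0 fF; have M0 : 0 <= M by have := M3; lra.
pose q := @chaos_coeff R n N c.
have QE d0 (T0 : measurableType d0) (P0 : probability T0 R) (Y : nat -> {RV P0 >-> R}) :
    \int[P0]_w f (\sum_(m < N) chaos_trunc c Y n m w) = \int[P0]_w f (mlpoly q (Y ^~ w)).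
  by apply: eq_Rintegral => w _; rewrite /q mlpoly_chaos.
rewrite !QE; have p0 : (0 < p)%N by exact: ltnW.
have H := @lindeberg _ _ _ _ _ P P' Z Z' n p F mu K f q p0 indepZ indepZ' fF
  iZ iZ' ZZ' muZ muZ' K0 step.
have [e [e0 ee He]] := @exists_eps_le R n N c M M0.
have W := @sum_sqrt_wnorm_le R n N c c_sym c_diag K M (ltW K0) KM M3 p e p2 e0 He.
have t0 : 0 <= total_norm n N c M.
  apply: sumr_ge0 => m _; rewrite !mulr_ge0 ?exprn_ge0//.
  by apply: sumr_ge0 => k _; exact: slice_norm_ge0.
have mu0 : 0 <= mu by apply: le_trans (muZ 0); apply: Rintegral_ge0 => w _; exact: exprn_ge0.
apply: (@le_trans _ _ ((2 / p`!%:R) * F * M ^+ p * total_norm n N c M * e ^+ (p - 2))%:E).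
  rewrite lee_fin; apply: le_trans H _.
  apply: (@le_trans _ _ (2 * F / p`!%:R * mu * (2 / M * total_norm n N c M * e ^+ (p - 2)))).
    by rewrite ler_wpM2l// !mulr_ge0 ?invr_ge0.
  have -> : 2 * F / p`!%:R * mu * (2 / M * total_norm n N c M * e ^+ (p - 2)) =
     (2 / p`!%:R * F) * (mu / M * 2) * total_norm n N c M * e ^+ (p - 2) by ring.
  (* The prefactor is absorbed by [2 * mu / M <= 2 <= M <= M ^+ p]. *)
  rewrite !ler_wpM2r ?exprn_ge0// ler_wpM2l ?mulr_ge0 ?invr_ge0//.
  have M1 : 0 < M by have := M3; lra.
  have muM1 : mu / M <= 1 by rewrite ler_pdivrMr ?mul1r.
  have MMp : M <= M ^+ p by rewrite ler_eXnr//; have := M3; lra.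
  by have := M3; lra.
have -> : ((2 / p`!%:R)%:E * F%:E * M%:E ^+ p = (2 / p`!%:R * F * M ^+ p)%:E)%E.
  by rewrite -EFin_expe -!EFinM.
have a0 : 0 <= 2 / p`!%:R * F * M ^+ p by rewrite !mulr_ge0 ?exprn_ge0.
rewrite (EFinM _ (e ^+ _)) (EFinM _ (total_norm _ _ _ _)).
have eek j : ((e ^+ j)%:E <= eps0 c M ^+ j)%E.
  elim: j => [|j IH]; first by rewrite expr0 expe0.
  by rewrite exprS EFinM expeS; apply: lee_pmul; rewrite ?lee_fin ?exprn_ge0.
apply: lee_pmul => //; first by rewrite -EFinM lee_fin mulr_ge0.
  by rewrite lee_fin exprn_ge0.
by rewrite lee_wpmul2l ?lee_fin//; exact: total_norm_le.
Qed.

(** The bound of [truncated] is free of [n] and [N]. Since [f] is Lipschitz, [L^2] approximation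
    moves each expectation by an arbitrarily small amount. *)
Lemma invariance_principle : Cb p f ->
  ((`|\int[P]_w f (S w) - \int[P']_w f (S' w)|)%:E <=
  (2 / p`!%:R)%:E * supnorm (derive1n p f) * M%:E ^+ p * N0 c M ^+ 2 * eps0 c M ^+ (p - 2))%E.
Proof.
move=> Cf; have [F [F0 -> fF]] := Cb_bounded_smooth Cf.
have [df bf _] := fF; have p0 : (0 < p)%N by exact: ltnW.
have [L HL] := bf 1%N p2.
have L0 : 0 <= L by exact: le_trans (HL 0).
have mf : measurable_fun setT f.
  by apply: continuous_measurable_fun => x; exact: (continuous_smooth (i := 0) fF p0).
have lip x y : `|f x - f y| <= L * `|x - y|.
  have df1 i : (i < 1)%N -> forall x : R, derivable (derive1n i f) x 1.
    by move=> i1 z; apply: df; exact: leq_trans i1 p0.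
  have := @taylor_bound R 1 f L y (x - y) df1 HL.
  rewrite /taylor_poly big_ord1 /= expr0 mulr1 expr1 !divr1.
  by rewrite [y + _]addrC subrK.
apply/lee_addgt0Pr => e e0.
(* [L + 1] keeps the divisor positive when [L = 0]. *)
pose a := e / (2 * (L + 1)).
have L1 : 0 < L + 1 by rewrite ltr_wpDl.
have a0 : 0 < a by rewrite divr_gt0// mulr_gt0.
have LaE : L * a + L * a <= e.
  have -> : e = (L + 1) * a + (L + 1) * a by rewrite /a; field; rewrite gt_eqF.
  by apply: lerD; rewrite ler_wpM2r ?(ltW a0)// lerDl.
have t1 := truncation_cvg c_nil hS a0.
have t2 := truncation_cvg c_nil hS' a0.
have [N HN] : exists N, (\forall n \near \oo,
   (Lnorm P 2%:E (fun w => (S w - \sum_(m < N) chaos_trunc c Z n m w)%:E) < a%:E)%E) /\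
  (\forall n \near \oo,
   (Lnorm P' 2%:E (fun w => (S' w - \sum_(m < N) chaos_trunc c Z' n m w)%:E) < a%:E)%E).
  by near \oo => N; exists N; split; near: N.
have [n [h1 h2]] : exists n,
   (Lnorm P 2%:E (fun w => (S w - \sum_(m < N) chaos_trunc c Z n m w)%:E) < a%:E)%E /\
   (Lnorm P' 2%:E (fun w => (S' w - \sum_(m < N) chaos_trunc c Z' n m w)%:E) < a%:E)%E.
  by case: HN => H1 H2; near \oo => n; exists n; split; near: n.
have mt d0 (T0 : measurableType d0) (P0 : probability T0 R) (Y : nat -> {RV P0 >-> R}) :
    measurable_fun setT (fun w => \sum_(m < N) chaos_trunc c Y n m w).
  by apply: measurable_sum => m; exact: measurable_chaos_trunc.
have bf0 : exists C, forall x, `|f x| <= C by exact: (bf 0%N p0).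
have g1 := lipschitz_expectation mf bf0 L0 lip (measurable_funPT S) (mt _ _ P Z) h1.
have g2 := lipschitz_expectation mf bf0 L0 lip (measurable_funPT S') (mt _ _ P' Z') h2.
have g3 := truncated n N F0 fF.
apply: le_trans (leeD g3 (_ : e%:E <= e%:E)%E) => //.
rewrite -EFinD lee_fin; move: g1 g2; clear -LaE.
set x := \int[P]_w f (S w); set y := \int[P']_w f (S' w).
set x' := \int[P]_w _; set y' := \int[P']_w _ => g1 g2.
have -> : x - y = (x' - y') + ((x - x') - (y - y')) by ring.
apply: le_trans (ler_normD _ _) _; rewrite lerD2l.
apply: le_trans (ler_normB _ _) _; apply: le_trans LaE; exact: lerD.
Unshelve. all: by end_near. Qed.

End invariance.

(** * Moments and the constants of the two estimates *)

Section moments.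
Context d (T : measurableType d) (R : realType) (P : probability T R).

Lemma expectation_Rintegral (U : T -> R) (x : R) : ('E_P[U] = x%:E)%E -> \int[P]_w U w = x.
Proof. by rewrite unlock /Rintegral => ->. Qed.

Lemma abs_moment_le (Z : nat -> {RV P >-> R}) (p : nat) (k : nat) :
  (abs_moment Z p%:R < +oo)%E ->
  rintegrable P (fun w => `|Z k w| ^+ p) /\
  \int[P]_w (`|Z k w| ^+ p) <= fine (abs_moment Z p%:R).
Proof.
move=> fin.
have E : ('E_P[fun w => (`|Z k w| `^ p%:R)%R] = \int[P]_w (`|Z k w| ^+ p)%:E)%E.
  by rewrite unlock; apply: eq_integral => w _; rewrite powR_mulrn.
have le_m : (\int[P]_w (`|Z k w| ^+ p)%:E <= abs_moment Z p%:R)%E.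
  by rewrite -E; apply: ereal_sup_ubound; exists k.
have m0 : (0 <= \int[P]_w (`|Z k w| ^+ p)%:E)%E.
  by apply: integral_ge0 => w _; rewrite lee_fin exprn_ge0.
have iZ : rintegrable P (fun w => `|Z k w| ^+ p).
  apply/integrableP; split.
    by apply/measurable_EFinP; apply: measurable_funX; exact: measurableT_comp.
  under eq_integral do rewrite /= ger0_norm ?exprn_ge0//.
  exact: le_lt_trans le_m fin.
split=> //; apply: fine_le => //.
  exact: integrable_fin_num.
by rewrite ge0_fin_numE//; exact: le_trans le_m.
Qed.

End moments.

Lemma Mbar_lty d (T : measurableType d) (R : realType) (P : probability T R)
    (Z : nat -> {RV P >-> R}) (b : R -> R) (p : R) : 1 <= b p ->
  (Mbar b Z p ^+ 2 < +oo)%E -> (abs_moment Z p < +oo)%E.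
Proof.
move=> b1; have b0 : 0 < b p by apply: lt_le_trans b1.
by case E : (abs_moment Z p) => [r| |]//; rewrite /Mbar E ?ltry// gt0_muley ?lte_fin// expeS mulyy.
Qed.

Section common.
Context d d' (T : measurableType d) (T' : measurableType d') (R : realType).
Variables (P : probability T R) (P' : probability T' R).
Variables (Z : nat -> {RV P >-> R}) (Z' : nat -> {RV P' >-> R}) (b : R -> R) (p : nat).
Hypothesis b1 : 1 <= b p%:R.
Let M := maxe (Mbar b Z p%:R ^+ 2)%E (Mbar b Z' p%:R ^+ 2)%E.
Hypothesis Mfin : (M < +oo)%E.

Definition common_moment := Num.max (fine (abs_moment Z p%:R)) (fine (abs_moment Z' p%:R)).

Lemma max_Mbar : [/\ (abs_moment Z p%:R < +oo)%E, (abs_moment Z' p%:R < +oo)%E &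
  M = ((b p%:R * common_moment) ^+ 2)%:E].
Proof.
have [f1 f2] : (Mbar b Z p%:R ^+ 2 < +oo)%E /\ (Mbar b Z' p%:R ^+ 2 < +oo)%E.
  by move: Mfin; rewrite /M gt_max => /andP[].
have m1 := Mbar_lty b1 f1; have m2 := Mbar_lty b1 f2.
split=> //; rewrite /M /Mbar /common_moment.
have z1 : (0 <= abs_moment Z p%:R)%E.
  apply: (@le_trans _ _ ('E_P[fun w => (`|Z 0%N w| `^ p%:R)%R]))%E.
    by apply: expectation_ge0 => w; exact: powR_ge0.
  by apply: ereal_sup_ubound; exists 0%N.
have z2 : (0 <= abs_moment Z' p%:R)%E.
  apply: (@le_trans _ _ ('E_P'[fun w => (`|Z' 0%N w| `^ p%:R)%R]))%E.
    by apply: expectation_ge0 => w; exact: powR_ge0.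
  by apply: ereal_sup_ubound; exists 0%N.
rewrite -(@fineK _ (abs_moment Z p%:R)) ?ge0_fin_numE//.
rewrite -(@fineK _ (abs_moment Z' p%:R)) ?ge0_fin_numE//=.
set x := fine _; set y := fine _.
have x0 : 0 <= x by exact: fine_ge0.
have y0 : 0 <= y by exact: fine_ge0.
have b0 : 0 <= b p%:R by apply: le_trans b1.
rewrite -!EFinM -EFin_max -!expr2; congr EFin.
have [xy|yx] := leP x y.
  by rewrite max_r// lerXn2r ?nnegrE ?mulr_ge0// ler_wpM2l.
by rewrite max_l// lerXn2r ?nnegrE ?mulr_ge0// ler_wpM2l// ltW.
Qed.

End common.

Section hybrid_steps.
Context d d' (T : measurableType d) (T' : measurableType d') (R : realType).
Variables (P : probability T R) (P' : probability T' R).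
Variables (Z : nat -> {RV P >-> R}) (Z' : nat -> {RV P' >-> R}) (mu : R).
Hypotheses (indepZ : mutually_independent Z) (indepZ' : mutually_independent Z').
Hypotheses (mean0 : forall k, \int[P]_w (Z k w ^+ 1) = 0)
           (mean0' : forall k, \int[P']_w (Z' k w ^+ 1) = 0).
Hypotheses (var1 : forall k, \int[P]_w (Z k w ^+ 2) = 1)
           (var1' : forall k, \int[P']_w (Z' k w ^+ 2) = 1).

Let hyb (g : R -> R) (i k : nat) (iZ : rintegrable P (fun w => g (Z k w)))
    (iZ' : rintegrable P' (fun w => g (Z' k w))) := @hybrid_moment _ _ _ _ _ P P' Z Z' i k g iZ iZ'.

(** The inequality required of [a] is a tangent-line bound: by convexity of [t ^ (p / 2)] at [t = 1]
    it holds with [a = p / 2], the value used below. The variance then makes its left-hand side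
    vanish on average. *)
Lemma moment_ge1 d0 (T0 : measurableType d0) (P0 : probability T0 R) (Y : T0 -> R)
    (p : nat) (a : R) : (2 <= p)%N -> measurable_fun setT Y ->
  (forall x : R, 0 <= x -> a * (x ^+ 2 - 1) <= x ^+ p - 1) ->
  rintegrable P0 (fun w => `|Y w| ^+ p) -> \int[P0]_w (Y w ^+ 2) = 1 ->
  1 <= \int[P0]_w (`|Y w| ^+ p).
Proof.
move=> p2 mY ha iY v1.
have iY2 := rintegrable_expr mY p2 iY.
have i1 (c : R) := rintegrable_cst P0 c.
have : \int[P0]_w (a * (Y w ^+ 2 + -1)) <= \int[P0]_w (`|Y w| ^+ p + -1).
  apply: ER_le => [||w].
  - by apply: rintegrableZ; exact: rintegrableD.
  - exact: rintegrableD.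
  - by rewrite -(real_normK (num_real (Y w))); exact: ha.
rewrite ERZ ?ERD//; try exact: rintegrableD.
by rewrite v1 !ER_cst subrr mulr0 subr_ge0.
Qed.

Section third.
Hypothesis iZ : forall k, rintegrable P (fun w => `|Z k w| ^+ 3).
Hypothesis iZ' : forall k, rintegrable P' (fun w => `|Z' k w| ^+ 3).
Hypothesis muZ : forall k, \int[P]_w (`|Z k w| ^+ 3) <= mu.
Hypothesis muZ' : forall k, \int[P']_w (`|Z' k w| ^+ 3) <= mu.

Lemma hybrid_step3 i : contractive_step (hybrid Z Z' i) 3 (7 / 3 * mu).
Proof.
have e1 k j : (j <= 3)%N -> rintegrable P (fun w => Z k w ^+ j).
  by move=> jp; exact: (rintegrable_expr (measurable_funPT (Z k)) jp (iZ k)).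
have e2 k j : (j <= 3)%N -> rintegrable P' (fun w => Z' k w ^+ j).
  by move=> jp; exact: (rintegrable_expr (measurable_funPT (Z' k)) jp (iZ' k)).
have h1 k := hyb (g := fun x => x ^+ 1) i (e1 k 1%N isT) (e2 k 1%N isT).
have h2 k := hyb (g := fun x => x ^+ 2) i (e1 k 2%N isT) (e2 k 2%N isT).
have h3 k := hyb (g := fun x => `|x| ^+ 3) i (iZ k) (iZ' k).
apply: contractive_step3.
- exact: hybrid_independent.
- by move=> k; exact: (h1 k).1.
- by move=> k; exact: (h2 k).1.
- by move=> k; have := (h1 k).2; rewrite mean0 mean0' if_same.
- by move=> k; have := (h2 k).2; rewrite var1 var1' if_same.
- apply: le_trans (muZ 0).
  apply: (@moment_ge1 _ _ _ _ _ (3 / 2)) (iZ 0%N) (var1 0%N) => // x x0.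
  have : 0 <= (x - 1) ^+ 2 * (2 * x + 1) by rewrite mulr_ge0 ?sqr_ge0//; lra.
  lra.
- by move=> k; exact: (h3 k).1.
- by move=> k; rewrite (h3 k).2; case: ifP.
Qed.
End third.

Section fourth.
Hypothesis iZ : forall k, rintegrable P (fun w => `|Z k w| ^+ 4).
Hypothesis iZ' : forall k, rintegrable P' (fun w => `|Z' k w| ^+ 4).
Hypothesis muZ : forall k, \int[P]_w (`|Z k w| ^+ 4) <= mu.
Hypothesis muZ' : forall k, \int[P']_w (`|Z' k w| ^+ 4) <= mu.
Hypotheses (skew0 : forall k, \int[P]_w (Z k w ^+ 3) = 0)
           (skew0' : forall k, \int[P']_w (Z' k w ^+ 3) = 0).

Lemma hybrid_step4 i : contractive_step (hybrid Z Z' i) 4 (3 * mu).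
Proof.
have e1 k j : (j <= 4)%N -> rintegrable P (fun w => Z k w ^+ j).
  by move=> jp; exact: (rintegrable_expr (measurable_funPT (Z k)) jp (iZ k)).
have e2 k j : (j <= 4)%N -> rintegrable P' (fun w => Z' k w ^+ j).
  by move=> jp; exact: (rintegrable_expr (measurable_funPT (Z' k)) jp (iZ' k)).
have h1 k := hyb (g := fun x => x ^+ 1) i (e1 k 1%N isT) (e2 k 1%N isT).
have h2 k := hyb (g := fun x => x ^+ 2) i (e1 k 2%N isT) (e2 k 2%N isT).
have h3 k := hyb (g := fun x => x ^+ 3) i (e1 k 3%N isT) (e2 k 3%N isT).
have h4 k := hyb (g := fun x => `|x| ^+ 4) i (iZ k) (iZ' k).
apply: contractive_step4.
- exact: hybrid_independent.
- by move=> k; exact: (h1 k).1.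
- by move=> k; exact: (h2 k).1.
- by move=> k; have := (h1 k).2; rewrite mean0 mean0' if_same.
- by move=> k; have := (h2 k).2; rewrite var1 var1' if_same.
- apply: le_trans (muZ 0).
  apply: (@moment_ge1 _ _ _ _ _ 2) (iZ 0%N) (var1 0%N) => // x x0.
  by have := sqr_ge0 (x ^+ 2 - 1); lra.
- by move=> k; exact: (h3 k).1.
- by move=> k; rewrite (h3 k).2 skew0 skew0' if_same.
- by move=> k; exact: (h4 k).1.
- by move=> k; rewrite (h4 k).2; case: ifP.
Qed.
End fourth.
End hybrid_steps.

Theorem theorem3p1 (R : realType) (b : R -> R)
    (hb : forall p : R, 2 <= p -> Burkholder_constant p (b p))
    (d d' : measure_display) (T : measurableType d) (T' : measurableType d')
    (P : probability T R) (P' : probability T' R)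
    (Z : nat -> {RV P >-> R}) (Z' : nat -> {RV P' >-> R})
    (indepZ : mutually_independent Z) (indepZ' : mutually_independent Z')
    (meanZ : forall k, ('E_P[Z k] = 0)%E)
    (meanZ' : forall k, ('E_P'[Z' k] = 0)%E)
    (varZ : forall k, ('E_P[fun w => (Z k w ^+ 2)%R] = 1)%E)
    (varZ' : forall k, ('E_P'[fun w => (Z' k w ^+ 2)%R] = 1)%E)
    (c : seq nat -> R)
    (c_sym : symmetric_coeff c) (c_diag : null_on_diagonals c)
    (c_nil : c [::] = 0) (N0_fin : (N0 c 1 < +oo)%E)
    (S : {RV P >-> R}) (S' : {RV P' >-> R})
    (hS : is_stoch_series c Z S) (hS' : is_stoch_series c Z' S') :
  (let M3 : \bar R := maxe (Mbar b Z 3 ^+ 2)%E (Mbar b Z' 3 ^+ 2)%E in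
   (M3 < +oo)%E ->
   forall f : R -> R, Cb 3 f ->
     (`| 'E_P[f \o S] - 'E_P'[f \o S'] | <=
      (1 / 3)%:E * supnorm (derive1n 3 f)
        * M3 ^+ 3 * N0 c (fine M3) ^+ 2 * eps0 c (fine M3))%E)
  /\
  ((forall k, ('E_P[fun w => (Z k w ^+ 3)%R] = 0)%E) ->
   (forall k, ('E_P'[fun w => (Z' k w ^+ 3)%R] = 0)%E) ->
   let M4 : \bar R := maxe (Mbar b Z 4 ^+ 2)%E (Mbar b Z' 4 ^+ 2)%E in
   (M4 < +oo)%E ->
   forall f : R -> R, Cb 4 f ->
     (`| 'E_P[f \o S] - 'E_P'[f \o S'] | <=
      (1 / 12)%:E * supnorm (derive1n 4 f)
        * M4 ^+ 4 * N0 c (fine M4) ^+ 2 * eps0 c (fine M4) ^+ 2)%E).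
Proof.
have m1 d0 (T0 : measurableType d0) (P0 : probability T0 R) (Y : nat -> {RV P0 >-> R}) :
    (forall k, ('E_P0[Y k] = 0)%E) -> forall k, \int[P0]_w (Y k w ^+ 1) = 0.
  by move=> Y0 k; have := expectation_Rintegral (Y0 k).
have m2 d0 (T0 : measurableType d0) (P0 : probability T0 R) (Y : nat -> {RV P0 >-> R}) :
    (forall k, ('E_P0[fun w => (Y k w ^+ 2)%R] = 1)%E) -> forall k, \int[P0]_w (Y k w ^+ 2) = 1.
  by move=> Y0 k; exact: expectation_Rintegral (Y0 k).
have diffE (p : nat) (f : R -> R) : (2 <= p)%N -> Cb p f ->
    (`| 'E_P[f \o S] - 'E_P'[f \o S'] | =
     (`|\int[P]_w f (S w) - \int[P']_w f (S' w)|%R)%:E)%E.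
  move=> p2 /Cb_bounded_smooth[F [_ _ fF]].
  have [_ /(_ 0%N (ltnW p2))[C fC] _] := fF.
  have mf : measurable_fun setT f.
    by apply: continuous_measurable_fun => x; exact: (continuous_smooth (i := 0) fF (ltnW p2)).
  have i1 : rintegrable P (f \o S).
    apply: (@rintegrable_le _ _ _ _ _ (fun=> C)) => [||w].
    - exact: measurableT_comp.
    - exact: rintegrable_cst.
    - exact: fC.
  have i2 : rintegrable P' (f \o S').
    apply: (@rintegrable_le _ _ _ _ _ (fun=> C)) => [||w].
    - exact: measurableT_comp.
    - exact: rintegrable_cst.
    - exact: fC.
  rewrite unlock -abse_EFin EFinB /Rintegral !fineK//; exact: integrable_fin_num.
split=> [M3 M3fin f Cf|skew skew' M4 M4fin f Cf].
  have hb3 : Burkholder_constant 3 (b 3) by apply: hb; lra.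
  have [b1 _] := hb3.
  have [a1 a2 ME] := @max_Mbar _ _ _ _ _ P P' Z Z' b 3 b1 M3fin.
  set mu := common_moment Z Z' 3 in ME.
  have iZ k := (abs_moment_le k a1).1.
  have iZ' k := (abs_moment_le k a2).1.
  have muZ k : \int[P]_w (`|Z k w| ^+ 3) <= mu.
    by apply: le_trans (abs_moment_le k a1).2 _; rewrite le_max lexx.
  have muZ' k : \int[P']_w (`|Z' k w| ^+ 3) <= mu.
    by apply: le_trans (abs_moment_le k a2).2 _; rewrite le_max lexx orbT.
  have step := hybrid_step3 indepZ indepZ' (m1 _ _ P Z meanZ) (m1 _ _ P' Z' meanZ')
    (m2 _ _ P Z varZ) (m2 _ _ P' Z' varZ') iZ iZ' muZ muZ'.
  have mu1 : 1 <= mu.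
    apply: le_trans (muZ 0).
    apply: (@moment_ge1 _ _ _ _ _ 3 (3 / 2)) (iZ 0%N) (m2 _ _ P Z varZ 0%N) => // x x0.
    have : 0 <= (x - 1) ^+ 2 * (2 * x + 1) by rewrite mulr_ge0 ?sqr_ge0//; lra.
    lra.
  (* Hence [7 / 3 * mu = 3 / 4 * (28 / 9 * mu) <= 3 / 4 * M], and also [3 <= M] and [mu <= M]. *)
  have bmu : 28 / 9 * mu <= (b 3 * mu) ^+ 2.
    have mu2 : mu <= mu ^+ 2 by rewrite ler_eXnr.
    rewrite exprMn; apply: ler_pM => //; [lra|exact: Burkholder_constant3_ge].
  rewrite (diffE 3%N)// /M3 ME /=.
  have -> : 1 / 3 = 2 / 3`!%:R :> R by rewrite !factS fact0; field.
  apply: (@invariance_principle _ _ _ _ _ P P' Z Z' 3 mu (7 / 3 * mu)) => //; try lra.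
  move=> k [|[|[|//]]] _; last by rewrite !m2.
    by rewrite (ER_cst P 1) (ER_cst P' 1).
  by rewrite !m1.
have hb4 : Burkholder_constant 4 (b 4) by apply: hb; lra.
have [b1 _] := hb4.
have [a1 a2 ME] := @max_Mbar _ _ _ _ _ P P' Z Z' b 4 b1 M4fin.
set mu := common_moment Z Z' 4 in ME.
have iZ k := (abs_moment_le k a1).1.
have iZ' k := (abs_moment_le k a2).1.
have muZ k : \int[P]_w (`|Z k w| ^+ 4) <= mu.
  by apply: le_trans (abs_moment_le k a1).2 _; rewrite le_max lexx.
have muZ' k : \int[P']_w (`|Z' k w| ^+ 4) <= mu.
  by apply: le_trans (abs_moment_le k a2).2 _; rewrite le_max lexx orbT.
have s3 k : \int[P]_w (Z k w ^+ 3) = 0 by exact: expectation_Rintegral (skew k).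
have s3' k : \int[P']_w (Z' k w ^+ 3) = 0 by exact: expectation_Rintegral (skew' k).
have step := hybrid_step4 indepZ indepZ' (m1 _ _ P Z meanZ) (m1 _ _ P' Z' meanZ')
  (m2 _ _ P Z varZ) (m2 _ _ P' Z' varZ') iZ iZ' muZ muZ' s3 s3'.
have mu1 : 1 <= mu.
  apply: le_trans (muZ 0).
  apply: (@moment_ge1 _ _ _ _ _ 4 2) (iZ 0%N) (m2 _ _ P Z varZ 0%N) => // x x0.
  by have := sqr_ge0 (x ^+ 2 - 1); lra.
(* Hence [3 * mu = 3 / 4 * (4 * mu) <= 3 / 4 * M]. *)
have bmu : 4 * mu <= (b 4 * mu) ^+ 2.
  have mu2 : mu <= mu ^+ 2 by rewrite ler_eXnr.
  rewrite exprMn; apply: ler_pM => //; [lra|exact: Burkholder_constant4_ge].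
rewrite (diffE 4%N)// /M4 ME /=.
have -> : 1 / 12 = 2 / 4`!%:R :> R by rewrite !factS fact0; field.
apply: (@invariance_principle _ _ _ _ _ P P' Z Z' 4 mu (3 * mu)) => //; try lra.
move=> k [|[|[|[|//]]]] _.
- by rewrite (ER_cst P 1) (ER_cst P' 1).
- by rewrite !m1.
- by rewrite !m2.
- by rewrite s3 s3'.
Qed.
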